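(* Let $\Theta:\mathbb{D}\to M_n$ be a contractive analytic function with $\Theta(0)=0$, and for each $A\in M_n$ with $\|A\|\le 1$ let $\Omega_{\Theta_A}$ be the Aleksandrov–Clark measure associated with $\Theta_A:=\Theta A^*$. Then $\Omega_{\Theta_0}=m$ (the measure for $A=0$ is $M_n$-valued normalized Lebesgue measure), and for every continuous function $f:\mathbb{T}\to\mathbb{C}$, $$\int_{\mathcal{U}(n)}\int_{\mathbb{T}} f(\zeta)\,\Omega_{\Theta_U}(d\zeta)\,dH(U)=\int_{\mathbb{T}} f(\zeta)\,m(d\zeta).$$
   Context: $\mathbb{D}$ is the open unit disc, $\mathbb{T}$ the unit circle, $M_n$ the complex $n\times n$ matrices with operator norm, $\mathbf 1$ the identity matrix, $\mathcal{U}(n)$ the group of unitary $n\times n$ matrices, and $H$ is normalized Haar measure on $\mathcal{U}(n)$. The measure $m$ is $M_n$-valued normalized Lebesgue measure on $\mathbb{T}$: $m(I)=\mu(I)\mathbf 1$ with $\mu$ normalized scalar Lebesgue measure. Contractive means $\|\Theta(z)\|\le 1$ for all $z\in\mathbb{D}$; since $\Theta(0)=0$ one has $\|\Theta(z)\|<1$ on $\mathbb{D}$. For $A\in M_n$ with $\|A\|\le1$ put $\Theta_A(z)=\Theta(z)A^*$ and $B_{\Theta_A}(z)=(\mathbf 1+\Theta(z)A^* )(\mathbf 1-\Theta(z)A^* )^{-1}$. Its real part $\frac12(B_{\Theta_A}(z)+B_{\Theta_A}(z)^* )$ is positive, and by the matrix-valued Herglotz theorem there is a unique positive $M_n$-valued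 Borel measure $\Omega_{\Theta_A}$ on $\mathbb{T}$ with $$\mathrm{Re}\,B_{\Theta_A}(z)=\mathrm{Re}\int_{\mathbb{T}}\frac{\zeta+z}{\zeta-z}\,\Omega_{\Theta_A}(d\zeta),\qquad z\in\mathbb{D},$$ where $\mathrm{Re}\,M=\frac12(M+M^* )$. *)

(* Defs.v *)
From HB Require Import structures.
From mathcomp Require Import all_boot all_order all_algebra.
From mathcomp Require Import sesquilinear spectral.
From mathcomp Require Import complex.
From mathcomp Require Import all_classical all_reals all_analysis.

Set Implicit Arguments.
Unset Strict Implicit.
Unset Printing Implicit Defensive.

Import Order.TTheory GRing.Theory Num.Theory.
Import numFieldNormedType.Exports.

Local Open Scope classical_set_scope.
Local Open Scope ring_scope.
Local Open Scope complex_scope.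
Local Open Scope sesquilinear_scope.

(* The complex numbers R[i] carry no topology in the libraries: we give them
   the one of their modulus, i.e. of the numFieldType R[i]. *)
HB.instance Definition _ (R : realType) := NormedModule.copy R[i] (R[i])^o.

Section complex_lemmas.
Variable R : realType.
Implicit Types z : R[i].

Lemma normRe_le z : (`|complex.Re z|)%:C <= `|z|.
Proof.
by rewrite normc_def lecR -sqrtr_sqr ler_wsqrtr// lerDl sqr_ge0.
Qed.

Lemma normIm_le z : (`|complex.Im z|)%:C <= `|z|.
Proof.
by rewrite normc_def lecR -sqrtr_sqr ler_wsqrtr// lerDr sqr_ge0.
Qed.

Lemma normr_realC (x : R) : `|x%:C| = `|x|%:C.
Proof. by rewrite normc_def /= expr0n addr0 sqrtr_sqr. Qed.

Lemma cvg_Re (I : Type) (F : set_system I) (FF : Filter F) (f : I -> R[i]) z :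
  f @ F --> z -> complex.Re (f x) @[x --> F] --> complex.Re z.
Proof.
move=> fz; apply/cvgrPdist_lt => e e0.
have e0' : 0 < e%:C :> R[i] by rewrite ltcR.
have /cvgrPdist_lt/(_ _ e0') := fz.
apply: filterS => x /= h.
rewrite -ltcR; apply: le_lt_trans h.
by rewrite -raddfB; exact: normRe_le.
Qed.

Lemma cvg_Im (I : Type) (F : set_system I) (FF : Filter F) (f : I -> R[i]) z :
  f @ F --> z -> complex.Im (f x) @[x --> F] --> complex.Im z.
Proof.
move=> fz; apply/cvgrPdist_lt => e e0.
have e0' : 0 < e%:C :> R[i] by rewrite ltcR.
have /cvgrPdist_lt/(_ _ e0') := fz.
apply: filterS => x /= h.
rewrite -ltcR; apply: le_lt_trans h.
by rewrite -raddfB; exact: normIm_le.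
Qed.

Lemma cvg_realC (I : Type) (F : set_system I) (FF : Filter F) (f : I -> R)
    (a : R) :
  f @ F --> a -> (f x)%:C @[x --> F] --> (a%:C : R[i]).
Proof.
move=> fa; apply/cvgrPdist_lt => e e0.
have eE : e = (complex.Re e)%:C.
  by case: e e0 => a' b; rewrite ltcE /= => /andP[/eqP -> _].
have e0' : 0 < complex.Re e by rewrite -(ltcR 0) -eE.
have /cvgrPdist_lt/(_ _ e0') := fa.
by apply: filterS => x /= h; rewrite -rmorphB /= normr_realC eE ltcR.
Qed.

End complex_lemmas.

Section mx_lemmas.
Variables (R : realType) (m n : nat).

Lemma cvg_mx_entry (I : Type) (F : set_system I) (FF : Filter F)
    (f : I -> 'M[R[i]]_(m, n)) (M : 'M[R[i]]_(m, n)) i j :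
  f @ F --> M -> f x i j @[x --> F] --> M i j.
Proof.
move=> fM A nA; apply: (fM [set N | A (N i j)]).
exists (fun i' j' => if (i' == i) && (j' == j) then A else setT).
  move=> i' j'; case: ifPn => [/andP[/eqP -> /eqP ->]//|_].
  exact: filterT.
by move=> N /= /(_ i j); rewrite !eqxx.
Qed.

Lemma cvg_scalar_mx (I : Type) (F : set_system I) (FF : Filter F)
    (f : I -> R[i]) (z : R[i]) :
  f @ F --> z -> (f x)%:M @[x --> F] --> (z%:M : 'M[R[i]]_n).
Proof.
move=> fz A [P nP PA].
have : \forall x \near F, forall i j, P i j ((f x)%:M i j).
  apply: filter_forall => i; apply: filter_forall => j.
  have [ij|ij] := eqVneq i j.
    rewrite ij; have := fz (P j j); rewrite /nbhs/=/nbhs/=.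
    have := nP j j; rewrite mxE eqxx mulr1n => nPj /(_ nPj).
    by apply: filterS => x; rewrite mxE eqxx mulr1n.
  have := nP i j; rewrite mxE (negbTE ij) mulr0n => /nbhs_singleton P0.
  by apply: nearW => x; rewrite mxE (negbTE ij) mulr0n.
by apply: filterS => x h; exact: PA.
Qed.

End mx_lemmas.

Notation borel T := (g_sigma_algebraType (open : set (set T))).

Definition circle (R : realType) : Type := [set z : R[i] | `|z| = 1].

HB.instance Definition _ (R : realType) := Topological.on (circle R).

Lemma circle1_subproof (R : realType) : (1 : R[i]) \in [set z : R[i] | `|z| = 1].
Proof. by rewrite inE /= normr1. Qed.

HB.instance Definition _ (R : realType) :=
  isPointed.Build (circle R) (exist _ 1 (@circle1_subproof R)).

Definition unitary (R : realType) (n : nat) : Type :=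
  [set U : 'M[R[i]]_n | U \is unitarymx].

HB.instance Definition _ (R : realType) (n : nat) :=
  Topological.on (unitary R n).

Lemma unitary1_subproof (R : realType) (n : nat) :
  (1%:M : 'M[R[i]]_n) \in [set U : 'M[R[i]]_n | U \is unitarymx].
Proof.
by rewrite inE /=; apply/unitarymxP; rewrite mul1mx trmx1 map_mx1.
Qed.

HB.instance Definition _ (R : realType) (n : nat) :=
  isPointed.Build (unitary R n) (exist _ 1%:M (@unitary1_subproof R n)).

Lemma umul_subproof (R : realType) (n : nat) (U V : unitary R n) :
  set_val U *m set_val V \in [set U : 'M[R[i]]_n | U \is unitarymx].
Proof.
by apply/mem_set; apply: mul_unitarymx; [exact: (set_valP U)|exact: (set_valP V)].
Qed.

Definition umul (R : realType) (n : nat) (U V : unitary R n) : unitary R n :=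
  exist _ (set_val U *m set_val V) (umul_subproof U V).

(* Left invariance; on a compact group this determines the normalized Haar
   measure, which is then also right invariant. *)
Definition is_haar (R : realType) (n : nat)
    (H : probability (borel (unitary R n)) R) : Prop :=
  forall (U : unitary R n) (E : set (borel (unitary R n))),
    measurable E -> H (umul U @^-1` E) = H E.

Section matrices.
Variables (R : realType) (n : nat).
Implicit Types A M : 'M[R[i]]_n.

Definition enorm (x : 'cV[R[i]]_n) : R :=
  Num.sqrt (\sum_(i < n) (complex.Re (x i 0) ^+ 2 + complex.Im (x i 0) ^+ 2)).

Definition opnorm A : R :=
  sup [set enorm (A *m x) | x in [set x : 'cV[R[i]]_n | enorm x <= 1]].

Definition psdmx M : Prop := forall x : 'cV[R[i]]_n, 0 <= (x^t* *m M *m x) 0 0.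

Definition mxRe M : 'M[R[i]]_n := 2^-1 *: (M + M^t*).

End matrices.

Section analytic.
Variables (R : realType) (n : nat).

(* Only the values of Theta in the disc matter: the radius r can always be
   taken smaller than the distance from z0 to the circle. *)
Definition analytic_on_disc (Theta : R[i] -> 'M[R[i]]_n) : Prop :=
  forall z0 : R[i], `|z0| < 1 ->
    exists (a : nat -> 'M[R[i]]_n) (r : R), 0 < r /\
      forall z : R[i], `|z - z0| < r%:C ->
        (\sum_(k < N) (z - z0) ^+ k *: a k) @[N --> \oo] --> Theta z.

Definition contractive_on_disc (Theta : R[i] -> 'M[R[i]]_n) : Prop :=
  forall z : R[i], `|z| < 1 -> opnorm (Theta z) <= 1.

End analytic.

(* Values on non-Borel sets are irrelevant. *)
Record pos_mxmeasure (R : realType) (n : nat) := PosMxMeasure {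
  mxmeas :> set (borel (circle R)) -> 'M[R[i]]_n ;
  mxmeas_psd : forall E, measurable E -> psdmx (mxmeas E) ;
  mxmeas0 : mxmeas set0 = 0 ;
  mxmeas_sigma_additive : forall F : nat -> set (borel (circle R)),
    (forall k, measurable (F k)) -> trivIset setT F ->
    (\sum_(k < N) mxmeas (F k)) @[N --> \oo] --> mxmeas (\bigcup_k F k) }.

Section entry_charges.
Variables (R : realType) (n : nat) (Om : pos_mxmeasure R n) (i j : 'I_n).

Definition mxmeas_Re (E : set (borel (circle R))) : \bar R :=
  (complex.Re (Om E i j))%:E.

Definition mxmeas_Im (E : set (borel (circle R))) : \bar R :=
  (complex.Im (Om E i j))%:E.

Let mxmeas_Re0 : mxmeas_Re set0 = 0%E.
Proof. by rewrite /mxmeas_Re mxmeas0 mxE. Qed.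

Let mxmeas_Im0 : mxmeas_Im set0 = 0%E.
Proof. by rewrite /mxmeas_Im mxmeas0 mxE. Qed.

Let mxmeas_Re_fin E : measurable E -> mxmeas_Re E \is a fin_num.
Proof. by []. Qed.

Let mxmeas_Im_fin E : measurable E -> mxmeas_Im E \is a fin_num.
Proof. by []. Qed.

Let mxmeas_Re_additive : semi_sigma_additive mxmeas_Re.
Proof.
move=> F mF tF _.
have := @mxmeas_sigma_additive _ _ Om _ mF tF => /(@cvg_mx_entry _ _ _ _ _ _ _ _ i j)/cvg_Re h.
rewrite (_ : (fun _ => _) = EFin \o
    (fun N => complex.Re ((\sum_(k < N) Om (F k)) i j))); last first.
  apply/funext => N /=; rewrite summxE raddf_sum big_mkord -sumEFin.
  by [].
by apply: cvg_EFin; [exact: nearW|exact: h].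
Qed.

Let mxmeas_Im_additive : semi_sigma_additive mxmeas_Im.
Proof.
move=> F mF tF _.
have := @mxmeas_sigma_additive _ _ Om _ mF tF => /(@cvg_mx_entry _ _ _ _ _ _ _ _ i j)/cvg_Im h.
rewrite (_ : (fun _ => _) = EFin \o
    (fun N => complex.Im ((\sum_(k < N) Om (F k)) i j))); last first.
  apply/funext => N /=; rewrite summxE raddf_sum big_mkord -sumEFin.
  by [].
by apply: cvg_EFin; [exact: nearW|exact: h].
Qed.

HB.instance Definition _ := isCharge.Build _ (borel (circle R)) R mxmeas_Re
  mxmeas_Re0 mxmeas_Re_fin mxmeas_Re_additive.

HB.instance Definition _ := isCharge.Build _ (borel (circle R)) R mxmeas_Im
  mxmeas_Im0 mxmeas_Im_fin mxmeas_Im_additive.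

End entry_charges.

Section charge_integral.
Context d (T : measurableType d) (R : realType).

(* Integral against a signed measure, through its Jordan decomposition. *)
Definition charge_integral (nu : {charge set T -> \bar R}) (g : T -> R) : R :=
  let h := svalP (cid (svalP (cid (Hahn_decomposition nu)))) in
  Rintegral (jordan_pos h) setT g - Rintegral (jordan_neg h) setT g.

End charge_integral.

Section matrix_integral.
Variables (R : realType) (n : nat).

(* Entrywise integral of a scalar function:
   d(mu + i nu) against u + i v is (u dmu - v dnu) + i (v dmu + u dnu). *)
Definition mxintegral (Om : pos_mxmeasure R n) (f : circle R -> R[i]) :
    'M[R[i]]_n :=
  \matrix_(i, j)
    let mu : {charge set (borel (circle R)) -> \bar R} := mxmeas_Re Om i j in
    let nu : {charge set (borel (circle R)) -> \bar R} := mxmeas_Im Om i j in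
    let u z := complex.Re (f z) in
    let v z := complex.Im (f z) in
    (charge_integral mu u - charge_integral nu v) +i*
    (charge_integral mu v + charge_integral nu u).

End matrix_integral.

Section integral_of_matrices.
Context d (T : measurableType d) (R : realType) (n : nat).
Variable H : {measure set T -> \bar R}.
Implicit Types F : T -> 'M[R[i]]_n.

Definition mxintegrable F : Prop := forall i j,
  H.-integrable setT (fun x => (complex.Re (F x i j))%:E) /\
  H.-integrable setT (fun x => (complex.Im (F x i j))%:E).

Definition integral_mx F : 'M[R[i]]_n := \matrix_(i, j)
  (Rintegral H setT (fun x => complex.Re (F x i j)) +i*
   Rintegral H setT (fun x => complex.Im (F x i j))).

End integral_of_matrices.

Section lebesgue_circle.
Variable R : realType.

Lemma expi_subproof (t : R) : (cos t +i* sin t) \in [set z : R[i] | `|z| = 1].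
Proof. by rewrite inE /= normc_def /= cos2Dsin2 sqrtr1. Qed.

Definition expi (t : R) : circle R := exist _ (cos t +i* sin t) (expi_subproof t).

Lemma continuous_expi : continuous expi.
Proof.
apply: continuous_comp_initial => t.
have -> : set_val \o expi = (fun t => (cos t)%:C + 'i%C * (sin t)%:C) :> (R -> R[i]).
  by apply/funext => s /=; rewrite [LHS]complexE.
apply: cvgD; first by apply: cvg_realC; exact: continuous_cos.
by apply: cvgMr; apply: cvg_realC; exact: continuous_sin.
Qed.

Lemma measurable_expi : measurable_fun [set: R] (expi : R -> borel (circle R)).
Proof.
apply: (@measurability _ _ R (borel (circle R)) _ _ (open : set (set (circle R)))) => //.
move=> _ [B oB <-]; rewrite setTI; apply: measurable_realfun.open_measurable.
by move/continuousP: continuous_expi; exact.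
Qed.

HB.instance Definition _ := isMeasurableFun.Build _ _ (measurableTypeR R)
  (borel (circle R)) (expi : measurableTypeR R -> borel (circle R)) measurable_expi.

Lemma twopi_gt0 : 0 < 2 * pi :> R.
Proof. by rewrite mulr_gt0 ?pi_gt0. Qed.

(* Image of the uniform probability on [0, 2 pi] under t |-> exp (i t). *)
Definition circle_lebesgue : probability (borel (circle R)) R :=
  distribution (uniform_prob twopi_gt0)
    (expi : measurableTypeR R -> borel (circle R)).

Variable n : nat.

Definition mxlebesgue_fun (E : set (borel (circle R))) : 'M[R[i]]_n :=
  ((fine (circle_lebesgue E))%:C)%:M.

Lemma mxlebesgue_psd E : measurable E -> psdmx (mxlebesgue_fun E).
Proof.
move=> _ x; rewrite mul_mx_scalar -scalemxAl mxE mulr_ge0//.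
  by rewrite ler0c fine_ge0.
rewrite mxE sumr_ge0// => k _; rewrite !mxE.
by rewrite mulrC mul_conjC_ge0.
Qed.

Lemma mxlebesgue0 : mxlebesgue_fun set0 = 0.
Proof. by rewrite /mxlebesgue_fun measure0 /= raddf0. Qed.

Lemma mxlebesgue_sigma_additive (F : nat -> set (borel (circle R))) :
  (forall k, measurable (F k)) -> trivIset setT F ->
  (\sum_(k < N) mxlebesgue_fun (F k)) @[N --> \oo] -->
    mxlebesgue_fun (\bigcup_k F k).
Proof.
move=> mF tF.
rewrite (_ : (fun _ => _) =
    (fun N => ((\sum_(k < N) fine (circle_lebesgue (F k)))%:C)%:M)); last first.
  by apply/funext => N; rewrite !raddf_sum.
apply: cvg_scalar_mx; apply: cvg_realC.
have mU : measurable (\bigcup_k F k) by exact: bigcup_measurable.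
have h : (\sum_(0 <= k < N) circle_lebesgue (F k))%E @[N --> \oo] -->
    ((fine (circle_lebesgue (\bigcup_k F k)))%:E : \bar R).
  rewrite fineK ?fin_num_measure//.
  exact: (@measure_semi_sigma_additive _ _ _ circle_lebesgue _ mF tF mU).
rewrite (_ : (fun _ => _) = fine \o
    (fun N => (\sum_(0 <= k < N) circle_lebesgue (F k))%E)); last first.
  apply/funext => N /=; rewrite big_mkord sum_fine// => k _.
  exact: (fin_num_measure circle_lebesgue _ (mF k)).
exact: (fine_cvg h).
Qed.

Definition mxlebesgue : pos_mxmeasure R n :=
  PosMxMeasure mxlebesgue_psd mxlebesgue0 mxlebesgue_sigma_additive.

End lebesgue_circle.

Section aleksandrov_clark.
Variables (R : realType) (n : nat) (Theta : R[i] -> 'M[R[i]]_n).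

(* On the disc the inverse exists whenever Theta is contractive and vanishes
   at 0 and the norm of A is at most 1. *)
Definition cayley (A : 'M[R[i]]_n) (z : R[i]) : 'M[R[i]]_n :=
  (1%:M + Theta z *m A^t*) *m invmx (1%:M - Theta z *m A^t*).

Definition herglotz_kernel (z : R[i]) (zeta : circle R) : R[i] :=
  (set_val zeta + z) / (set_val zeta - z).

Definition is_clark_measure (A : 'M[R[i]]_n) (Om : pos_mxmeasure R n) : Prop :=
  forall z : R[i], `|z| < 1 ->
    mxRe (cayley A z) = mxRe (mxintegral Om (herglotz_kernel z)).

End aleksandrov_clark.

(* Main.v *)
(* Idea.  Write P_z for the Poisson kernel, C(X) = (1 + X)(1 - X)^-1 and A' for the adjoint
   of A.  For A = s U with U unitary and 0 <= s <= 1, taking real parts turns the Herglotz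
   representation into  Re C(Theta(z) A') = \int P_z dOmega_A.
   Finite combinations of Poisson kernels are uniformly dense in the continuous functions
   (Riemann sums of the Poisson integral over the 2^K-th roots of unity), and all the
   Omega_A have total mass 1, so it is enough to integrate P_z: the integral against m is 1,
   and one has to show that the Haar average of Re C(Theta(z) U') is the identity.
   For X_U = s Theta(z) U', the identity C(X) + C(-X) = 2 C(X^2) and the invariance of the
   Haar measure under U |-> w U, where w^(2^k) = -1, show that Re C(X_U^(2^k)) and
   Re C(X_U^(2^(k+1))) have the same average.  For s < 1, X_U^(2^k) tends to 0, hence the
   average is C(0) = 1; then let s tend to 1.  The Poisson integrals give the domination.
   Finally Omega_0 = m, since a measure is determined by its Poisson integrals. *)
Require Import Defs.
From HB Require Import structures.
From mathcomp Require Import all_boot all_order all_algebra.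
From mathcomp Require Import sesquilinear spectral.
From mathcomp Require Import complex.
From mathcomp Require Import all_classical all_reals all_analysis.
From mathcomp Require Import measurable_realfun.
From mathcomp Require Import ring lra.

Set Implicit Arguments.
Unset Strict Implicit.
Unset Printing Implicit Defensive.

Import Order.TTheory GRing.Theory Num.Theory.
Import numFieldNormedType.Exports.

Local Open Scope classical_set_scope.
Local Open Scope ring_scope.

(** * Integration against signed measures *)

(** Nothing is assumed about the way [Omega A] depends on [A], so the measurability of the integral
    of [f] against [Omega U] as a function of [U] has to be proved together with its Haar average.
    Both are obtained for Poisson kernels, where the Herglotz identity gives an explicit continuous
    function of [U], and both survive linear combinations and uniform limits. All estimates come
    from positivity: total mass 1 bounds every entry of the integral of [u] by twice the supremum of
    [|u|], with no dependence on [A], so one constant dominates for all [s] and [U]. The factor s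
    supplies decay: the argument uses only that Theta(z) U' is a contraction, and powers of a
    contraction need not tend to 0. The doubling identity serves twice: for matrices it carries the
    Haar average from X to X^2, for scalars it evaluates in closed form the sum of the Poisson
    kernels over the 2^K-th roots of unity. *)

Section charge_integral_theory.
Context d (T : measurableType d) (R : realType).
Implicit Types (nu : {charge set T -> \bar R}) (g : T -> R).

Definition bounded_measurable g :=
  measurable_fun setT g /\ exists M : R, forall x, `|g x| <= M.

Lemma bounded_measurable_integrable (mu : {finite_measure set T -> \bar R}) g :
  bounded_measurable g -> mu.-integrable setT (EFin \o g).
Proof.
move=> [mg [M gM]]; apply: measurable_bounded_integrable => //.
  by rewrite ltey_eq fin_num_measure.
exists M; split; first exact: num_real.
by move=> x Mx y _; exact: le_trans (gM y) (ltW Mx).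
Qed.

(** The integral of a simple function, for a bare set function: the same formula then applies to a
    charge and to both of its Jordan parts. *)
Definition step_sum (nu : set T -> \bar R) (h : T -> R) : R :=
  \sum_(x \in range h) x * fine (nu (h @^-1` [set x])).

Import HBNNSimple.

Lemma Rintegral_step_lim (mu : {finite_measure set T -> \bar R}) g
    (mg : measurable_fun [set: T] (EFin \o g)) :
  (forall x, 0 <= g x) -> bounded_measurable g ->
  step_sum mu (nnsfun_approx measurableT mg m) @[m --> \oo] -->
    Rintegral mu setT g.
Proof.
move=> g0 bg.
pose h := nnsfun_approx measurableT mg.
have ig := bounded_measurable_integrable mu bg.
have hE m : sintegral mu (h m) = (step_sum mu (h m))%:E.
  rewrite sintegralE /step_sum -fsumEFin//.
  apply: eq_fsbigr => x _; rewrite EFinM fineK// fin_num_measure//.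
have ndh x : nondecreasing_seq (h^~ x).
  by move=> m n mn; exact/lefP/nd_nnsfun_approx.
have hg x : EFin \o h^~ x @ \oo --> (EFin \o g) x.
  by apply: cvg_nnsfun_approx => // y _; rewrite lee_fin.
have g0' x : (0 <= (EFin \o g) x)%E by rewrite lee_fin.
have := nd_ge0_integral_lim mu g0' ndh hg.
have c : cvgn (sintegral mu \o h).
  apply: ereal_nondecreasing_is_cvgn => i j ij /=.
  by apply: le_sintegral => // x; exact: ndh.
move=> intE.
have : sintegral mu \o h @ \oo --> (\int[mu]_x (g x)%:E)%E by rewrite intE.
rewrite -[X in _ --> X]fineK; last exact: integrable_fin_num.
move=> /fine_cvg; apply: cvg_trans; apply: near_eq_cvg.
by apply: nearW => m /=; rewrite hE.
Qed.

(** The very Hahn decomposition chosen inside [charge_integral], named so that [charge_integralE]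
    holds by conversion. *)
Definition hahn_pair nu := svalP (cid (svalP (cid (Hahn_decomposition nu)))).

Lemma charge_integralE nu g : charge_integral nu g =
  Rintegral (jordan_pos (hahn_pair nu)) setT g -
  Rintegral (jordan_neg (hahn_pair nu)) setT g.
Proof. by []. Qed.

Lemma jordan_fineE nu E : measurable E -> fine (nu E) =
  fine (jordan_pos (hahn_pair nu) E) - fine (jordan_neg (hahn_pair nu) E).
Proof.
move=> mE; rewrite [in LHS](jordan_decomp (hahn_pair nu) mE) /cadd/= cscaleN1.
by rewrite fineB//; exact: fin_num_measure.
Qed.

(** The approximating simple functions depend on [g] alone, so both Jordan parts are approximated
    along the same sequence and the difference of their step sums is the step sum of [nu]. The
    chosen Hahn decomposition thereby disappears from the limit. *)
Lemma charge_integral_step_lim nu g (mg : measurable_fun [set: T] (EFin \o g)) :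
  (forall x, 0 <= g x) -> bounded_measurable g ->
  step_sum nu (nnsfun_approx measurableT mg m) @[m --> \oo] -->
    charge_integral nu g.
Proof.
move=> g0 bg; rewrite charge_integralE; set h := hahn_pair nu.
have -> : (fun m => step_sum nu (nnsfun_approx measurableT mg m)) =
    (fun m => step_sum (jordan_pos h) (nnsfun_approx measurableT mg m) -
              step_sum (jordan_neg h) (nnsfun_approx measurableT mg m)).
  apply/funext => m; rewrite /step_sum !fsbig_finite//= -sumrB.
  by apply: eq_bigr => x _; rewrite -mulrBr [in LHS]jordan_fineE.
by apply: cvgB; exact: Rintegral_step_lim.
Qed.

Lemma charge_integralD nu g1 g2 : bounded_measurable g1 -> bounded_measurable g2 ->
  charge_integral nu (fun x => g1 x + g2 x) =
  charge_integral nu g1 + charge_integral nu g2.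
Proof.
move=> b1 b2; rewrite !charge_integralE !RintegralD//;
  do ?exact: bounded_measurable_integrable.
by rewrite opprD addrACA.
Qed.

Lemma charge_integralZ nu c g : bounded_measurable g ->
  charge_integral nu (fun x => c * g x) = c * charge_integral nu g.
Proof.
move=> bg; rewrite !charge_integralE !RintegralZl//;
  do ?exact: bounded_measurable_integrable.
by rewrite mulrBr.
Qed.

Lemma charge_integral_cst nu c :
  charge_integral nu (fun=> c) = c * fine (nu setT).
Proof.
by rewrite charge_integralE !Rintegral_cst// -mulrBr jordan_fineE.
Qed.

End charge_integral_theory.

(** * Positive semidefinite matrices *)

Section psd_matrices.
Variables (R : realType) (n : nat).
Implicit Types (M A : 'M[R[i]]_n) (x : 'cV[R[i]]_n).
Local Open Scope complex_scope.
Local Open Scope sesquilinear_scope.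

Definition quad_form M x : R[i] := (x^t* *m M *m x) 0 0.

Lemma quad_formE M x :
  quad_form M x = \sum_i \sum_j Num.conj (x i 0) * M i j * x j 0.
Proof.
rewrite /quad_form mxE exchange_big /=; apply: eq_bigr => j _.
by rewrite mxE mulr_suml; apply: eq_bigr => i _; rewrite !mxE.
Qed.

Lemma quad_formD M A x :
  quad_form (M + A) x = quad_form M x + quad_form A x.
Proof. by rewrite /quad_form mulmxDr mulmxDl mxE. Qed.

Lemma quad_formZ a M x :
  quad_form (a *: M) x = a * quad_form M x.
Proof. by rewrite /quad_form -scalemxAr -scalemxAl mxE. Qed.

Lemma conj_realC (c : R) : Num.conj c%:C = c%:C :> R[i].
Proof. exact: conjc_real. Qed.

Lemma conj_complexE (z : R[i]) : Num.conj z = complex.Re z +i* (- complex.Im z).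
Proof. by case: z. Qed.

Lemma psdmx_quad_form M x : psdmx M ->
  complex.Im (quad_form M x) = 0 /\ 0 <= complex.Re (quad_form M x).
Proof. by move=> /(_ x); rewrite lecE => /andP[/eqP]. Qed.

Lemma delta_quad_form M a b :
  (delta_mx 0 a : 'rV_n) *m M *m (delta_mx b 0 : 'cV_n) = (M a b)%:M.
Proof.
by rewrite -rowE -colE [LHS]mx11_scalar; congr (_%:M); rewrite !mxE.
Qed.

Lemma quad_form_delta1 M i :
  quad_form M (delta_mx i 0) = M i i.
Proof.
by rewrite /quad_form trmx_delta map_delta_mx delta_quad_form mxE eqxx mulr1n.
Qed.

(** Polarization: letting [w] be 1 or ['i] isolates the off-diagonal entries. *)
Lemma quad_form_delta2 M i j w :
  quad_form M (delta_mx i 0 + w *: delta_mx j 0) =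
  M i i + Num.conj w * w * M j j + w * M i j + Num.conj w * M j i.
Proof.
set x := _ + _; rewrite /quad_form.
have -> : x^t* = delta_mx 0 i + Num.conj w *: delta_mx 0 j.
  by rewrite /x linearD linearZ /= !trmx_delta map_mxD map_mxZ !map_delta_mx.
rewrite /x !mulmxDl !mulmxDr -!scalemxAl -!scalemxAr.
rewrite !delta_quad_form !scale_scalar_mx.
by rewrite -!raddfD mxE eqxx mulr1n /=; ring.
Qed.

(** Positivity on all complex vectors makes the quadratic form real; reality at [e_i + e_j] and at
    [e_i + 'i e_j] forces [M j i] to be the conjugate of [M i j]. *)
Lemma psdmx_herm M : psdmx M -> M^t* = M.
Proof.
move=> pM; apply/matrixP => i j; rewrite !mxE.
have d k : complex.Im (M k k) = 0.
  by have [] := psdmx_quad_form (delta_mx k 0) pM; rewrite quad_form_delta1.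
have [+ _] := psdmx_quad_form (delta_mx i 0 + 1 *: delta_mx j 0) pM.
have [+ _] := psdmx_quad_form (delta_mx i 0 + 'i *: delta_mx j 0) pM.
rewrite (quad_form_delta2 M i j 'i) (quad_form_delta2 M i j 1) conjC1 [Num.conj 'i]conjCi.
move: (d i) (d j).
case: (M i i) => a b; case: (M j j) => a' b'.
case: (M i j) => p q; case: (M j i) => r s /= -> ->.
simpc => h1 h2.
by apply/eqP; rewrite eq_complex /=; apply/andP; split; apply/eqP; lra.
Qed.

(** On [e_i + w e_j] with [|w| = 1] the hypotheses give [|A i i + A j j + 2 Re (w * A i j)| <= 2 *
    c]. The diagonal entries are at most [c] in modulus, which leaves the factor 2; [w = 1] and
    [w = 'i] give the two parts. *)
Lemma psdmx_bound c A : psdmx (c%:C%:M - A) -> psdmx (c%:C%:M + A) ->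
  forall i j, `|complex.Re (A i j)| <= 2 * c /\ `|complex.Im (A i j)| <= 2 * c.
Proof.
move=> pm pp i j.
have hA : A^t* = A.
  have := psdmx_herm pp; rewrite linearD /= map_mxD tr_scalar_mx map_scalar_mx /=.
  by rewrite conj_realC => /addrI.
have d k : complex.Im (A k k) = 0 /\ `|complex.Re (A k k)| <= c.
  have [] := psdmx_quad_form (delta_mx k 0) pm.
  have [] := psdmx_quad_form (delta_mx k 0) pp.
  rewrite !quad_form_delta1 !mxE !eqxx !mulr1n; case: (A k k) => a b /= h1 h2 h3 h4.
  by split; [lra|rewrite ler_norml; apply/andP; split; lra].
have c0 : 0 <= c := le_trans (normr_ge0 _) (d i).2.
have [->|ij] := eqVneq i j.
  rewrite (d j).1 normr0; split; last by rewrite mulr_ge0.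
  by apply: le_trans (d j).2 _; lra.
have hji : A j i = Num.conj (A i j) by rewrite -[in LHS]hA !mxE.
have key w : Num.conj w * w = 1 -> `|complex.Re (w * A i j)| <= 2 * c.
  move=> w1.
  have [_] := psdmx_quad_form (delta_mx i 0 + w *: delta_mx j 0) pm.
  have [_] := psdmx_quad_form (delta_mx i 0 + w *: delta_mx j 0) pp.
  rewrite (quad_form_delta2 _ i j w) (quad_form_delta2 _ i j w) !w1 !mxE !eqxx (negbTE ij) eq_sym (negbTE ij).
  rewrite !mulr1n !mulr0n hji.
  move: (d i) (d j); rewrite !ler_norml.
  move: w w1 => [w1 w2] _.
  case: (A i i) => a b; case: (A j j) => a' b'; case: (A i j) => p q /=.
  move=> [_ /andP[A1 A2]] [_ /andP[A3 A4]]; simpc => /= B1 B2.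
  by apply/andP; split; lra.
have := key 1; rewrite conjC1 mulr1 mul1r => /(_ erefl) k1.
split => //.
have : `|complex.Re ('i * A i j)| <= 2 * c.
  by apply: key; rewrite conjCi mulNr -expr2 sqr_i opprK.
by case: (A i j) => p q; move=> /=; simpc; rewrite /= normrN.
Qed.

End psd_matrices.

(** * Integration against matrix-valued measures *)

Lemma cvg_seq_eq (R : realType) (f g : nat -> R) (a b : R) : (forall m, f m = g m) ->
  f @ \oo --> a -> g @ \oo --> b -> a = b.
Proof. by move=> /funext -> fa gb; exact: (cvg_unique _ fa gb). Qed.

Section cvg_complex.
Variable R : realType.
Local Open Scope complex_scope.

Lemma cvg_complex (I : Type) (F : set_system I) (FF : Filter F)
    (f g : I -> R) (a b : R) :
  f @ F --> a -> g @ F --> b ->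
  (f x +i* g x) @[x --> F] --> (a +i* b : R[i]).
Proof.
move=> fa gb.
have -> : (fun x => f x +i* g x) =
    (fun x => (f x)%:C + 'i * (g x)%:C) :> (I -> R[i]).
  by apply/funext => x; rewrite [LHS]complexE.
rewrite [X in _ --> X]complexE /=.
apply: cvgD; first exact: cvg_realC.
by apply: cvgM; [exact: cvg_cst|exact: cvg_realC].
Qed.

Lemma mul_i_complex (a b : R) : 'i * (a +i* b) = (- b) +i* a.
Proof. by simpc. Qed.

Lemma realC_mul_complex (c a b : R) : c%:C * (a +i* b) = (c * a) +i* (c * b).
Proof. by simpc. Qed.

Lemma cvg_bigsum (V : normedModType R[i]) (I : Type) (F : set_system I)
    (FF : Filter F) (J : Type) (s : seq J) (f : J -> I -> V) (a : J -> V) :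
  (forall j, f j @ F --> a j) ->
  (\sum_(j <- s) f j x) @[x --> F] --> \sum_(j <- s) a j.
Proof.
move=> fa; elim: s => [|j s IH].
  by under eq_fun do rewrite big_nil; rewrite big_nil; exact: cvg_cst.
under eq_fun do rewrite big_cons; rewrite big_cons.
by apply: cvgD; [exact: fa|exact: IH].
Qed.

End cvg_complex.

Section mxint.
Variables (R : realType) (n : nat).
Implicit Types (Om : pos_mxmeasure R n) (g u v : borel (circle R) -> R).
Local Open Scope complex_scope.
Local Open Scope sesquilinear_scope.

Definition mxint Om g : 'M[R[i]]_n := \matrix_(i, j)
  (charge_integral (mxmeas_Re Om i j) g +i* charge_integral (mxmeas_Im Om i j) g).

Lemma mxintD Om u v : bounded_measurable u -> bounded_measurable v ->
  mxint Om (fun x => u x + v x) = mxint Om u + mxint Om v.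
Proof.
by move=> bu bv; apply/matrixP => i j; rewrite !mxE !charge_integralD.
Qed.

Lemma mxintZ Om (c : R) u : bounded_measurable u ->
  mxint Om (fun x => c * u x) = c%:C *: mxint Om u.
Proof.
move=> bu; apply/matrixP => i j; rewrite !mxE !charge_integralZ//.
by rewrite realC_mul_complex.
Qed.

Lemma mxint_cst Om c : mxint Om (fun=> c) = c%:C *: Om setT.
Proof.
apply/matrixP => i j; rewrite !mxE !charge_integral_cst /=.
by case: (Om setT i j) => a b; simpc.
Qed.

Lemma mxintegralE Om (f : circle R -> R[i]) : mxintegral Om f =
  mxint Om (fun x => complex.Re (f x)) + 'i *: mxint Om (fun x => complex.Im (f x)).
Proof.
apply/matrixP => i j; rewrite !mxE mul_i_complex.
by congr (_ +i* _); exact: addrC.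
Qed.

Import HBNNSimple.

(** The step sums assemble into [S m], a combination of matrices [Om E] with nonnegative
    coefficients; its quadratic form is nonnegative and converges to that of the integral. *)
Lemma mxint_psd Om g : bounded_measurable g -> (forall x, 0 <= g x) ->
  psdmx (mxint Om g).
Proof.
move=> bg g0 x.
have mg : measurable_fun setT (EFin \o g) by apply/measurable_EFinP; exact: bg.1.
pose h m := nnsfun_approx measurableT mg m.
pose S m : 'M[R[i]]_n := \matrix_(i, j)
  (step_sum (mxmeas_Re Om i j) (h m) +i* step_sum (mxmeas_Im Om i j) (h m)).
have SE m : S m = \sum_(c <- finmap.enum_fset (fset_set (range (h m)))) c%:C *: Om (h m @^-1` [set c]).
  apply/matrixP => i j; rewrite mxE summxE /step_sum !fsbig_finite//=.
  apply/eqP; rewrite eq_complex !raddf_sum /=; apply/andP; split; apply/eqP.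
    by apply: eq_bigr => c _; rewrite mxE; case: (Om _ i j) => a b; simpc.
  by apply: eq_bigr => c _; rewrite mxE; case: (Om _ i j) => a b; simpc.
have S0 m : 0 <= quad_form (S m) x.
  rewrite SE big_seq; elim/big_rec: _ => [|c A cr A0].
    by rewrite /quad_form mulmx0 mul0mx mxE.
  rewrite quad_formD quad_formZ; apply: addr_ge0 A0.
  apply: mulr_ge0; last exact: mxmeas_psd.
  move: cr; rewrite in_fset_set// inE => -[y _ <-].
  by rewrite ler0c.
have Scvg : quad_form (S m) x @[m --> \oo] --> quad_form (mxint Om g) x.
  rewrite quad_formE; under eq_fun do rewrite quad_formE.
  apply: cvg_bigsum => i; apply: cvg_bigsum => j.
  apply: cvgM; last exact: cvg_cst.
  apply: cvgM; first exact: cvg_cst.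
  under eq_fun do rewrite mxE; rewrite mxE.
  by apply: cvg_complex; exact: charge_integral_step_lim.
have SR m : complex.Im (quad_form (S m) x) = 0 /\ 0 <= complex.Re (quad_form (S m) x).
  by have := S0 m; rewrite lecE => /andP[/eqP].
rewrite -/(quad_form _ _) lecE; apply/andP; split.
  have c : (complex.Im (quad_form (S m) x)) @[m --> \oo] -->
    complex.Im (quad_form (mxint Om g) x) by exact: cvg_Im.
  by apply/eqP; exact: (cvg_seq_eq (fun m => (SR m).1) c (cvg_cst 0)).
have : (complex.Re (quad_form (S m) x)) @[m --> \oo] -->
    complex.Re (quad_form (mxint Om g) x) by exact: cvg_Re.
by move/cvgr_to_ge; apply; apply: nearW => m; exact: (SR m).2.
Qed.

(** [mxint_psd] covers nonnegative integrands only: a constant [M] dominating [|g|] is added, and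
    its Hermitian integral is cancelled afterwards. *)
Lemma mxint_herm Om g : bounded_measurable g -> (mxint Om g)^t* = mxint Om g.
Proof.
move=> bg; have [mg [M gM]] := bg.
have bM : bounded_measurable (fun _ : borel (circle R) => M).
  by split; [exact: measurable_cst|exists `|M|].
have bgM : bounded_measurable (fun x => g x + M).
  split; first by apply: measurable_funD => //; exact: measurable_cst.
  by exists (M + `|M|) => x; rewrite (le_trans (ler_normD _ _))// lerD2r.
have hM : (mxint Om (fun=> M))^t* = mxint Om (fun=> M).
  rewrite mxint_cst linearZ /= map_mxZ /= conj_realC.
  by rewrite (psdmx_herm (mxmeas_psd Om measurableT)).
have := psdmx_herm (mxint_psd Om bgM _).
rewrite mxintD// linearD /= map_mxD hM => h.
apply: (@addIr _ (mxint Om (fun=> M))); apply: h => x.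
by rewrite -lerBlDr sub0r; have := gM x; rewrite ler_norml => /andP[].
Qed.

(** Integrals of real functions are Hermitian, so the imaginary part of [f] contributes a
    skew-Hermitian matrix, which [mxRe] kills. *)
Lemma mxRe_mxintegral Om (f : circle R -> R[i]) :
  bounded_measurable (fun x : borel (circle R) => complex.Re (f x)) ->
  bounded_measurable (fun x : borel (circle R) => complex.Im (f x)) ->
  mxRe (mxintegral Om f) = mxint Om (fun x => complex.Re (f x)).
Proof.
move=> bu bv; rewrite mxintegralE /mxRe [(_ + _)^T]linearD /= [(_ *: _)^T]linearZ /= map_mxD map_mxZ /=.
rewrite !mxint_herm// [Num.conj 'i]conjCi scaleNr addrACA subrr addr0.
set J := mxint _ _; rewrite -[in LHS](scale1r J) -scalerDl scalerA.
by rewrite -[1 + 1]/(2%:R) mulVf ?scale1r// pnatr_eq0.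
Qed.

(** The functions [M + u] and [M - u] are nonnegative, so with total mass 1 the integral of [u] lies
    between [-M] and [M] in the order of Hermitian matrices. The bound is the same for all such
    [Om], which is what the dominated convergence arguments need. *)
Lemma mxint_bound Om u M : Om setT = 1%:M -> bounded_measurable u ->
  (forall x, `|u x| <= M) ->
  forall i j, `|complex.Re (mxint Om u i j)| <= 2 * M /\
              `|complex.Im (mxint Om u i j)| <= 2 * M.
Proof.
move=> Om1 bu uM.
have bM : bounded_measurable (fun _ : borel (circle R) => M).
  by split; [exact: measurable_cst|exists `|M|].
have bZ c : bounded_measurable (fun x => c * u x).
  split; first by apply: measurable_funM; [exact: measurable_cst|exact: bu.1].
  by exists (`|c| * M) => x; rewrite normrM ler_wpM2l.
have bD c : `|c| = 1 -> psdmx (M%:C%:M + c%:C *: mxint Om u).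
  move=> c1.
  have -> : M%:C%:M + c%:C *: mxint Om u = mxint Om (fun x => M + c * u x).
    by rewrite mxintD// mxintZ// mxint_cst Om1 scalemx1.
  apply: mxint_psd.
    split; first by apply: measurable_funD; [exact: bM.1|exact: (bZ c).1].
    exists (`|M| + M) => x; rewrite (le_trans (ler_normD _ _))// lerD2l.
    by rewrite normrM c1 mul1r.
  move=> x; rewrite -lerBlDl sub0r.
  have : `|c * u x| <= M by rewrite normrM c1 mul1r.
  by rewrite ler_norml => /andP[].
apply: psdmx_bound; last by have := bD 1; rewrite normr1 scale1r; exact.
by have := bD (- 1); rewrite normrN1 rmorphN scaleN1r; exact.
Qed.

End mxint.

(** * The unit circle *)

Lemma continuous_borel_measurable (R : realType) (T : ptopologicalType) (f : T -> R) :
  continuous f -> measurable_fun setT (f : borel T -> R).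
Proof.
move=> /continuousP cf.
apply: (measurability _ (RGenOpens.measurableE R)) => _ [_ [a [b ->] <-]].
rewrite setTI; apply: sub_sigma_algebra; apply: cf.
exact: interval_open.
Qed.

Section circle_topology.
Variable R : realType.
Implicit Types (u : circle R -> R) (z : R[i]).
Local Open Scope complex_scope.

(** The modulus of [R[i]] takes its values in [R[i]]; this real polynomial form keeps estimates
    within reach of [lra] and [nra]. *)
Definition normsq z : R := complex.Re z ^+ 2 + complex.Im z ^+ 2.

Lemma normsq_ge0 z : 0 <= normsq z.
Proof. by rewrite addr_ge0 ?sqr_ge0. Qed.

Lemma normr_lt_normsq z (d : R) : 0 <= d -> (`|z| < d%:C) = (normsq z < d ^+ 2).
Proof.
move=> d0; rewrite normc_def ltcR -/(normsq z).
by rewrite -ltr_sqr ?nnegrE ?sqrtr_ge0// sqr_sqrtr ?normsq_ge0.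
Qed.

Lemma normr_le_normsq z (d : R) : 0 <= d -> (`|z| <= d%:C) = (normsq z <= d ^+ 2).
Proof.
move=> d0; rewrite normc_def lecR -/(normsq z).
by rewrite -ler_sqr ?nnegrE ?sqrtr_ge0// sqr_sqrtr ?normsq_ge0.
Qed.

Lemma normsq_circle (x : circle R) : normsq (set_val x) = 1.
Proof.
have : `|set_val x| = 1 := set_valP x.
rewrite normc_def => /(congr1 (@complex.Re R)) h.
have {}h : Num.sqrt (normsq (set_val x)) = 1 := h.
rewrite -[LHS]sqr_sqrtr ?normsq_ge0// h; exact: mul1r.
Qed.

Lemma expi_surj (x : circle R) : exists2 t, t \in `[- pi, pi]%R & expi t = x.
Proof.
have := normsq_circle x; rewrite /normsq; case E : (set_val x) => [a b] /= ab1.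
have a1 : -1 <= a <= 1.
  by rewrite -ler_norml -sqrtr_sqr -[leRHS]sqrtr1 ler_wsqrtr// -ab1 lerDl sqr_ge0.
have sq : Num.sqrt (1 - a ^+ 2) = `|b|.
  by rewrite -sqrtr_sqr -ab1 addrC addKr.
have [b0|b0] := leP 0 b.
  exists (acos a).
    by rewrite in_itv /= acos_lepi// (le_trans _ (acos_ge0 a1))// oppr_le0 pi_ge0.
  apply: val_inj; rewrite [RHS]E /= acosK ?in_itv//= sin_acos// sq ger0_norm//.
exists (- acos a).
  by rewrite in_itv /= lerN2 acos_lepi//= (le_trans _ (pi_ge0 R))// oppr_le0 acos_ge0.
apply: val_inj; rewrite [RHS]E /= cosN sinN acosK ?in_itv//= sin_acos// sq ltr0_norm//.
by rewrite opprK.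
Qed.

Lemma compact_circle : compact [set: circle R].
Proof.
have -> : [set: circle R] = expi (R := R) @` `[- pi, pi].
  apply/seteqP; split=> // x _; have [t tI <-] := expi_surj x.
  by exists t.
apply: continuous_compact; last exact: segment_compact.
by apply: continuous_subspaceT; exact: continuous_expi.
Qed.

Lemma nbhs_circleP (x : circle R) (A : set (circle R)) : nbhs x A <->
  exists2 d : R, 0 < d & forall y, normsq (set_val x - set_val y) < d -> A y.
Proof.
split=> [[B [[C oC CB] Bx] BA]|[d d0 dA]].
  have : nbhs (set_val x) C.
    by apply: open_nbhs_nbhs; split => //; rewrite -CB in Bx.
  move=> /nbhs_ballP[e /= e0 eC].
  have eE : e = (complex.Re e)%:C.
    by case: e e0 {eC} => a b; rewrite ltcE /= => /andP[/eqP -> _].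
  have e0' : 0 < complex.Re e by rewrite -(ltcR 0) -eE.
  exists (complex.Re e ^+ 2); first by rewrite exprn_gt0.
  move=> y xy; apply: BA; rewrite -CB; apply: eC.
  by rewrite -ball_normE /= eE normr_lt_normsq// ltW.
exists ((set_val : circle R -> R[i]) @^-1` ball (set_val x) (Num.sqrt d)%:C).
  split.
    exists (ball (set_val x) (Num.sqrt d)%:C) => //.
    by apply: ball_open; rewrite ltcR sqrtr_gt0.
  by apply: ballxx; rewrite ltcR sqrtr_gt0.
move=> y /=; rewrite -ball_normE /= normr_lt_normsq ?sqrtr_ge0//.
by rewrite sqr_sqrtr ?(ltW d0)//; exact: dA.
Qed.

Lemma continuous_circle_bounded u : continuous u -> exists M, forall x, `|u x| <= M.
Proof.
move=> cu.
have /compact_bounded [M [_ uM]] : compact (u @` [set: circle R]).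
  apply: continuous_compact; last exact: compact_circle.
  exact: continuous_subspaceT.
by exists (M + 1) => x; apply: uM; [rewrite ltrDl|exists x].
Qed.

Lemma continuous_bounded_measurable u : continuous u ->
  bounded_measurable (u : borel (circle R) -> R).
Proof.
move=> cu; split; last exact: continuous_circle_bounded.
exact: continuous_borel_measurable.
Qed.

(** [circle] is given a topology only, so uniform continuity is extracted from compactness in its
    near-covering form, with [d] tending to 0 from the right. *)
Lemma circle_unif_continuous u : continuous u -> forall e : R, 0 < e ->
  exists2 d : R, 0 < d & forall x y : circle R,
    normsq (set_val x - set_val y) < d -> `|u x - u y| < e.
Proof.
move=> cu e e0.
have /compact_near_coveringP nc := compact_circle.
have := nc R (at_right 0) (fun d x => forall y : circle R,
  normsq (set_val x - set_val y) < d -> `|u x - u y| < e) _ _.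
case=> [x _|d /= d0 dP].
  have e2 : 0 < e / 2 by rewrite divr_gt0.
  have := cu x; rewrite /continuous_at => /cvgrPdist_lt /(_ _ e2) /nbhs_circleP[d d0 dP].
  (* The distances are squared, and [|x - z|^2 <= 2 |x - y|^2 + 2 |y - z|^2]: two bounds by [d / 4]
     give [d]. *)
  have d4 : 0 < d / 4 by rewrite divr_gt0.
  exists ([set y | normsq (set_val x - set_val y) < d / 4], [set t | t < d / 4]).
    split; first by apply/nbhs_circleP; exists (d / 4).
    exact: nbhs_right_lt.
  move=> [y t] /= [xy td] z yz.
  have -> : u y - u z = (u x - u z) - (u x - u y) by ring.
  rewrite (le_lt_trans (ler_normB _ _))// [e]splitr ltrD//; apply: dP.
    have := lt_trans yz td; move: xy; rewrite /normsq.
    case: (set_val x) (set_val y) (set_val z) => [x1 x2] [y1 y2] [z1 z2] /= h1 h2.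
    have := sqr_ge0 (x1 - y1 - (y1 - z1)); have := sqr_ge0 (x2 - y2 - (y2 - z2)).
    nra.
  by apply: lt_le_trans xy _; lra.
exists (d / 2).
  by rewrite divr_gt0.
move=> x y xy; apply: (dP (d / 2)) => //=; last by rewrite divr_gt0.
by rewrite sub0r normrN ger0_norm ?divr_ge0 ?ltW//; lra.
Qed.

End circle_topology.

(** * Density of the Poisson kernels *)

Section poisson_kernel.
Variable R : realType.
Implicit Types (x y : circle R) (z : R[i]) (u : circle R -> R).
Local Open Scope complex_scope.

Definition pker z x : R := complex.Re (herglotz_kernel z x).

Lemma normr_lt1_normsq z : (`|z| < 1) = (normsq z < 1).
Proof. by rewrite (@normr_lt_normsq _ _ 1)// expr1n. Qed.

Lemma normsq_eq0 z : (normsq z == 0) = (z == 0).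
Proof.
by case: z => a b; rewrite paddr_eq0 ?sqr_ge0// !sqrf_eq0 eq_complex.
Qed.

Lemma circle_sub_neq0 z x : `|z| < 1 -> set_val x - z != 0.
Proof.
rewrite normr_lt1_normsq => z1; apply/eqP => /subr0_eq xz.
by move: z1; rewrite -xz normsq_circle ltxx.
Qed.

Lemma pkerE z x : `|z| < 1 ->
  pker z x = (1 - normsq z) / normsq (set_val x - z).
Proof.
move=> z1; have := circle_sub_neq0 x z1; rewrite -normsq_eq0.
have := normsq_circle x; rewrite /pker /herglotz_kernel /normsq.
case: (set_val x) z {z1} => [a b] [c d] /= ab1 h.
(* Writing 1 as [|x|^2] makes the identity homogeneous: the real part of [(x + z) conj(x - z)] is
   [|x|^2 - |z|^2]. *)
rewrite -ab1 !mulrA; field.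
by rewrite !expr2 in h *.
Qed.

(** [|x - z|^2 <= 4]. This positive lower bound, uniform in [x], is what excludes singular matrices
    in [clark_unitmx]. *)
Lemma pker_ge z x : `|z| < 1 -> (1 - normsq z) / 4 <= pker z x.
Proof.
move=> z1; rewrite pkerE//.
have n0 : 0 < normsq (set_val x - z).
  by rewrite lt_def normsq_ge0 normsq_eq0 circle_sub_neq0.
have z1' := z1; rewrite normr_lt1_normsq in z1'.
rewrite ler_pM2l ?subr_gt0// lef_pV2 ?posrE//.
have := normsq_circle x; move: z1'; rewrite /normsq.
case: (set_val x) z {z1 n0} => [a b] [c d] /= h1 h2.
have := sqr_ge0 (a + c); have := sqr_ge0 (b + d).
nra.
Qed.

Lemma pker_ge0 z x : `|z| < 1 -> 0 <= pker z x.
Proof.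
move=> z1; apply: le_trans (pker_ge x z1).
by rewrite divr_ge0// subr_ge0 ltW// -normr_lt1_normsq.
Qed.

Lemma continuous_herglotz_kernel z : `|z| < 1 ->
  continuous (fun x => complex.Re (herglotz_kernel z x)) /\
  continuous (fun x => complex.Im (herglotz_kernel z x)).
Proof.
move=> z1.
have c : continuous (herglotz_kernel z).
  move=> x; have cv : set_val y @[y --> x] --> set_val x.
    exact: initial_continuous.
  have cN : (set_val y + z) @[y --> x] --> set_val x + z.
    exact: (cvgD cv (cvg_cst z)).
  have cD : (set_val y - z) @[y --> x] --> set_val x - z.
    exact: (cvgB cv (cvg_cst z)).
  have cV : (set_val y - z)^-1 @[y --> x] --> (set_val x - z)^-1.
    by apply: cvgV cD; exact: circle_sub_neq0.
  exact: (cvgM cN cV).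
split => x.
  by apply: (@cvg_Re _ _ _ (nbhs_filter x) (herglotz_kernel z)); exact: c.
by apply: (@cvg_Im _ _ _ (nbhs_filter x) (herglotz_kernel z)); exact: c.
Qed.

Lemma bounded_measurable_pker z : `|z| < 1 ->
  bounded_measurable (pker z : borel (circle R) -> R).
Proof.
by move=> z1; apply: continuous_bounded_measurable; case: (continuous_herglotz_kernel z1).
Qed.

Lemma mxRe_mxint_herglotz n (Om : pos_mxmeasure R n) z : `|z| < 1 ->
  mxRe (mxintegral Om (herglotz_kernel z)) = mxint Om (pker z).
Proof.
move=> /continuous_herglotz_kernel[cr ci].
by apply: mxRe_mxintegral; exact: continuous_bounded_measurable.
Qed.

Lemma pker0 x : pker 0 x = 1.
Proof.
by rewrite pkerE ?normr0// subr0 normsq_circle /normsq /= expr0n /= addr0 subr0 divr1.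
Qed.

Definition disc_cayley z : R[i] := (1 + z) / (1 - z).

Lemma herglotz_kernelE z x : herglotz_kernel z x = disc_cayley (z / set_val x).
Proof.
have x0 : set_val x != 0.
  by rewrite -normsq_eq0 normsq_circle oner_eq0.
rewrite /herglotz_kernel /disc_cayley.
have -> : 1 + z / set_val x = (set_val x + z) / set_val x.
  by rewrite mulrDl divff.
have -> : 1 - z / set_val x = (set_val x - z) / set_val x.
  by rewrite mulrBl divff.
by rewrite invf_div mulrA divfK.
Qed.

Lemma normr_lt1_neq1 z : `|z| < 1 -> 1 - z != 0.
Proof.
by move=> z1; rewrite subr_eq0; apply: contraTneq z1 => <-; rewrite normr1 ltxx.
Qed.

Lemma disc_cayleyDN z : `|z| < 1 ->
  disc_cayley z + disc_cayley (- z) = 2 * disc_cayley (z ^+ 2).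
Proof.
move=> z1; have h1 := normr_lt1_neq1 z1.
have h2 : 1 - - z != 0 by apply: normr_lt1_neq1; rewrite normrN.
have h3 : 1 - z ^+ 2 != 0.
  by apply: normr_lt1_neq1; rewrite normrX exprn_ilt1.
rewrite /disc_cayley; field.
by rewrite h3 opprK in h2 *; rewrite h1 h2.
Qed.

(** The terms [k] and [k + 2 ^ K.-1] have opposite arguments, so [disc_cayley] doubling merges them
    and leaves the same sum for [w ^+ 2], [z ^+ 2] and half as many terms. The condition on [w] is
    guarded because a single term imposes none. *)
Lemma sum_disc_cayley K w z : `|w| = 1 -> `|z| < 1 ->
  ((0 < K)%N -> w ^+ (2 ^ K.-1) = -1) ->
  \sum_(k < 2 ^ K) disc_cayley (w ^+ k * z) = (2 ^ K)%:R * disc_cayley (z ^+ (2 ^ K)).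
Proof.
elim: K w z => [|K IH] w z w1 z1 wK.
  by rewrite big_ord1 expr0 !mul1r expr1.
have -> : \sum_(k < 2 ^ K.+1) disc_cayley (w ^+ k * z) =
    \sum_(k < 2 ^ K + 2 ^ K) disc_cayley (w ^+ k * z).
  by rewrite -!(big_mkord xpredT (fun k => disc_cayley (w ^+ k * z))) expnS mul2n addnn.
rewrite big_split_ord /= -big_split /=.
under eq_bigr => k _.
  rewrite exprD (wK isT) mulN1r mulNr disc_cayleyDN; last first.
    by rewrite normrM normrX w1 expr1n mul1r.
  rewrite exprMn -exprM mulnC exprM.
  over.
rewrite -mulr_sumr IH.
- by rewrite mulrA -natrM -expnS -exprM -expnS.
- by rewrite normrX w1 expr1n.
- by rewrite normrX exprn_ilt1.
- by case: K {IH} wK => // K wK _; rewrite -exprM -expnS; exact: wK.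
Qed.

Lemma expiE (t : R) : set_val (expi t) = cos t +i* sin t.
Proof. by []. Qed.

Lemma expi_natmul (t : R) k : set_val (expi (k%:R * t)) = set_val (expi t) ^+ k.
Proof.
elim: k => [|k IH]; first by rewrite mul0r expr0 expiE cos0 sin0.
rewrite exprSr -IH !expiE -natr1 mulrDl mul1r cosD sinD.
by simpc; congr (_ +i* _); ring.
Qed.

(** The difference [disc_cayley z - 1] is [2 * z / (1 - z)], whose denominator is at least
    [1 - q >= 1 / 2] in modulus. *)
Lemma disc_cayley_near1 z (q : R) : `|z| <= q%:C -> q <= 2^-1 ->
  `|complex.Re (disc_cayley z) - 1| <= 4 * q.
Proof.
move=> zq q2.
have q0 : 0 <= q by rewrite -ler0c; exact: le_trans zq.
have z1 : `|z| < 1.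
  by apply: le_lt_trans zq _; rewrite (ltcR _ 1); lra.
have n1 := normr_lt1_neq1 z1.
have e : disc_cayley z - 1 = 2 * z / (1 - z) by rewrite /disc_cayley; field.
have -> : complex.Re (disc_cayley z) - 1 = complex.Re (disc_cayley z - 1).
  by rewrite raddfB.
rewrite -lecR; apply: le_trans (normRe_le _) _.
rewrite e normrM normfV normrM ler_pdivrMr ?normr_gt0//.
have h : (1 - q)%:C <= `|1 - z|.
  rewrite rmorphB /=; apply: le_trans (lerB_normD _ _).
  by rewrite normr1 normrN lerB.
apply: (@le_trans _ _ ((4 * q)%:C * (1 - q)%:C)); last first.
  by rewrite ler_wpM2l// ler0c; lra.
apply: (@le_trans _ _ (2 * q)%:C).
  by rewrite rmorphM /= rmorph_nat normr_nat ler_wpM2l.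
by rewrite -rmorphM /= lecR; nra.
Qed.

Definition circle_root N k : circle R := expi (k%:R * (2 * pi / N%:R)).

Lemma normr_circle x : `|set_val x| = 1.
Proof. exact: (set_valP x). Qed.

Lemma normsq_realC_mul (r : R) x : normsq (r%:C * set_val x) = r ^+ 2.
Proof.
have := normsq_circle x; rewrite /normsq; case: (set_val x) => a b /= ab1.
by simpc => /=; rewrite !exprMn -mulrDr ab1 mulr1.
Qed.

(** With [v = r / x] the kernels are real parts of [disc_cayley (w ^+ k * v)], so their mean is
    exactly the real part of [disc_cayley (v ^+ (2 ^ K))]: the discrete counterpart of the Poisson
    kernel having mean 1. *)
Lemma pker_sum_near1 (r : R) K x : 0 <= r -> r < 1 -> r ^+ (2 ^ K) <= 2^-1 ->
  `|(\sum_(k < 2 ^ K) pker (r%:C * set_val (circle_root (2 ^ K) k)) x) / (2 ^ K)%:R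
    - 1| <= 4 * r ^+ (2 ^ K).
Proof.
move=> r0 r1 rK.
pose w := set_val (expi (2 * pi / (2 ^ K)%:R : R)).
pose v := r%:C / set_val x.
have v1 : `|v| < 1.
  by rewrite normrM normfV normr_circle invr1 mulr1 normr_realC ger0_norm// (ltcR _ 1).
have N0 : (2 ^ K)%:R != 0 :> R by rewrite pnatr_eq0 expn_eq0.
have sE : \sum_(k < 2 ^ K) herglotz_kernel (r%:C * set_val (circle_root (2 ^ K) k)) x =
    (2 ^ K)%:R * disc_cayley (v ^+ (2 ^ K)).
  rewrite -(@sum_disc_cayley K w) ?normr_circle//.
    apply: eq_bigr => k _; rewrite herglotz_kernelE /circle_root expi_natmul -/w.
    by rewrite mulrAC mulrC.
  case: K rK @w N0 => // K _ w N0 _ /=.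
  rewrite -expi_natmul.
  have -> : (2 ^ K)%:R * (2 * pi / (2 ^ K.+1)%:R) = pi :> R.
    by rewrite expnS natrM; field; rewrite pnatr_eq0 expn_eq0.
  by rewrite expiE cospi sinpi; apply/eqP; rewrite eq_complex /= oppr0 !eqxx.
have -> : \sum_(k < 2 ^ K) pker (r%:C * set_val (circle_root (2 ^ K) k)) x =
    (2 ^ K)%:R * complex.Re (disc_cayley (v ^+ (2 ^ K))).
  rewrite -raddf_sum sE.
  have -> : (2 ^ K)%:R = ((2 ^ K)%:R : R)%:C :> R[i] by rewrite rmorph_nat.
  by case: (disc_cayley _) => a b; simpc.
rewrite mulrC mulKf//.
apply: disc_cayley_near1 => //.
by rewrite normrX normrM normfV normr_circle invr1 mulr1 normr_realC ger0_norm// rmorphXn.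
Qed.

(** The numerator [1 - r^2] is at most [2 (1 - r)], and the denominator
    [|x - r y|^2 = (1 - r)^2 + r |x - y|^2] is at least [d / 2]. *)
Lemma pker_far (r d : R) x y : 2^-1 <= r -> r < 1 -> 0 < d ->
  d <= normsq (set_val x - set_val y) ->
  pker (r%:C * set_val y) x <= 4 * (1 - r) / d.
Proof.
move=> r2 r1 d0 dxy.
have r0 : 0 <= r by lra.
rewrite pkerE; last by rewrite normr_lt1_normsq normsq_realC_mul exprn_ilt1.
rewrite normsq_realC_mul.
have e : normsq (set_val x - r%:C * set_val y) =
    (1 - r) ^+ 2 + r * normsq (set_val x - set_val y).
  have := normsq_circle x; have := normsq_circle y; rewrite /normsq.
  case: (set_val x) (set_val y) => [a b] [c f] /=; simpc => /= h1 h2.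
  by nra.
have ed : d / 2 <= normsq (set_val x - r%:C * set_val y).
  rewrite e; have := sqr_ge0 (1 - r); nra.
rewrite ler_pdivrMr; last by apply: lt_le_trans ed; rewrite divr_gt0.
apply: (@le_trans _ _ (4 * (1 - r) / d * (d / 2))); last first.
  by rewrite ler_wpM2l// divr_ge0 ?(ltW d0)//; lra.
have -> : 4 * (1 - r) / d * (d / 2) = 2 * (1 - r) by field; rewrite gt_eqF.
nra.
Qed.

Lemma pker_dense u (e : R) : continuous u -> 0 < e ->
  exists N (c : 'I_N -> R) (z : 'I_N -> R[i]), (forall k, `|z k| < 1) /\
    forall x, `|u x - \sum_k c k * pker (z k) x| <= e.
Proof.
move=> cu e0.
have [B0 uB0] := continuous_circle_bounded cu.
pose B := `|B0| + 1.
have B1 : 1 <= B by rewrite lerDr.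
have uB x : `|u x| <= B.
  by rewrite (le_trans (uB0 x))// (le_trans (ler_norm _))// lerDl.
have e4 : 0 < e / 4 by rewrite divr_gt0.
have [d d0 ud] := circle_unif_continuous cu e4.
(* Chosen for the far nodes: there a term is at most [2 * B * (4 * t / d)], which this makes at most
   [e / 4]. *)
pose t := Num.min 2^-1 (e * d / (32 * B)).
have t0 : 0 < t.
  by rewrite lt_min invr_gt0 ltr0n /= divr_gt0 ?mulr_gt0//; lra.
have t2 : t <= 2^-1 by rewrite ge_min lexx.
have tB : t <= e * d / (32 * B) by rewrite ge_min lexx orbT.
pose r := 1 - t.
have r1 : r < 1 by rewrite /r; lra.
have r2 : 2^-1 <= r by rewrite /r; lra.
have r0 : 0 <= r by lra.
(* [e / (16 * B)] makes the error [B * (4 * eta)] at most [e / 4]; [1 / 8] ensures [s <= 2] and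
   meets the hypothesis of [pker_sum_near1]. *)
pose eta := Num.min (2^-1 / 4) (e / (16 * B)).
have eta0 : 0 < eta.
  by rewrite lt_min !divr_gt0// mulr_gt0//; lra.
have eta8 : eta <= 2^-1 / 4 by rewrite ge_min lexx.
have etaB : eta <= e / (16 * B) by rewrite ge_min lexx orbT.
have [K rK] : exists K, r ^+ (2 ^ K) <= eta.
  have /cvgrPdist_lt/(_ _ eta0) : r ^+ n @[n --> \oo] --> 0.
    by apply: cvg_expr; rewrite ger0_norm.
  move=> [K _ /(_ K (leqnn K))] /=.
  rewrite sub0r normrN ger0_norm ?exprn_ge0// => /ltW h; exists K.
  by apply: le_trans h; apply: ler_wiXn2l => //; [exact: ltW|exact/ltnW/ltn_expl].
pose N := (2 ^ K)%N.
have N0 : 0 < N%:R :> R by rewrite ltr0n expn_gt0.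
pose o k : circle R := circle_root N k.
pose P k x := pker (r%:C * set_val (o k)) x.
have z1 k : `|r%:C * set_val (o k)| < 1.
  by rewrite normr_lt1_normsq normsq_realC_mul exprn_ilt1.
exists N, (fun k => u (o k) / N%:R), (fun k => r%:C * set_val (o k)).
split => // x.
pose s := (\sum_(k < N) P k x) / N%:R.
have s1 : `|s - 1| <= 4 * eta.
  apply: le_trans (pker_sum_near1 x r0 r1 _) _; last by rewrite ler_wpM2l.
  by apply: le_trans rK _; lra.
have -> : u x - \sum_(k < N) u (o k) / N%:R * pker (r%:C * set_val (o k)) x =
    (\sum_(k < N) (u x - u (o k)) * P k x) / N%:R - u x * (s - 1).
  rewrite mulrBr mulr1 opprB addrCA; congr (_ + _).
  rewrite /s mulrA mulr_sumr !mulr_suml -sumrB -sumrN; apply: eq_bigr => k _.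
  by rewrite /P; field; rewrite gt_eqF.
(* One bound for both kinds of nodes: the first summand comes from uniform continuity near [x], the
   second from the decay of the kernel away from [x]. *)
have far k : `|(u x - u (o k)) * P k x| <= e / 4 * P k x + e / 4.
  have P0 : 0 <= P k x by exact: pker_ge0.
  rewrite normrM (ger0_norm P0).
  have [xo|xo] := ltP (normsq (set_val x - set_val (o k))) d.
    by rewrite -[leLHS]addr0 lerD ?(ltW e4)// ler_wpM2r// ltW// ud.
  have eP0 : 0 <= e / 4 * P k x := mulr_ge0 (ltW e4) P0.
  rewrite -[leLHS]add0r; apply: lerD => //.
  have Pk : P k x <= 4 * (1 - r) / d by exact: pker_far.
  apply: (@le_trans _ _ (2 * B * (4 * t / d))).
    rewrite ler_pM//.
      by rewrite (le_trans (ler_normB _ _))// mulr_natl mulr2n lerD.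
    by move: Pk; rewrite /r opprB addrCA subrr addr0.
  rewrite mulrA ler_pdivrMr//.
  move: tB; rewrite ler_pdivlMr; last by rewrite mulr_gt0//; lra.
  by move=> h; nra.
have sB : s <= 2 by move: s1; rewrite ler_norml => /andP[_]; lra.
(* Near nodes cost [e / 4 * s <= e / 2], far nodes [e / 4], and the deviation of [s] from 1 the last
   [e / 4]. *)
apply: le_trans (ler_normB _ _) _; rewrite [leRHS](_ : e = e / 4 * 3 + e / 4); last by lra.
rewrite lerD//; last first.
  rewrite normrM; apply: (@le_trans _ _ (B * (4 * eta))); first by rewrite ler_pM.
  move: etaB; rewrite ler_pdivlMr; last by rewrite mulr_gt0//; lra.
  by move=> h; nra.
rewrite normrM normfV (ger0_norm (ltW N0)) ler_pdivrMr//.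
apply: le_trans (ler_norm_sum _ _ _) _.
apply: (@le_trans _ _ (\sum_(k < N) (e / 4 * P k x + e / 4))).
  by apply: ler_sum => k _; exact: far.
rewrite big_split /= -mulr_sumr sumr_const card_ord -[X in e / 4 * X](divfK (negbT (gt_eqF N0))) -/s.
rewrite -[_ *+ N]mulr_natr.
have h : e / 4 * s <= e / 4 * 2 by rewrite ler_pM2l.
nra.
Qed.

End poisson_kernel.

(** * Measures are determined by continuous functions *)

Section bounded_convergence.
Context d (T : measurableType d) (R : realType).

Lemma Rintegral_bounded_cvg (mu : {finite_measure set T -> \bar R})
    (f : nat -> T -> R) (g : T -> R) (M : R) :
  (forall m, measurable_fun setT (f m)) -> (forall m x, `|f m x| <= M) ->
  (forall x, f m x @[m --> \oo] --> g x) ->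
  bounded_measurable g /\
  Rintegral mu setT (f m) @[m --> \oo] --> Rintegral mu setT g.
Proof.
move=> mf fM fg.
have mg : measurable_fun setT g by apply: measurable_fun_cvg mf _ => x _; exact: fg.
have bM : bounded_measurable (fun _ : T => M).
  by split; [exact: measurable_cst|exists `|M|].
have gM x : `|g x| <= M.
  have /cvgr_to_le : `|f m x| @[m --> \oo] --> `|g x| by apply: cvg_norm; exact: fg.
  by apply; exact: nearW.
have bg : bounded_measurable g by split; [|exists M].
split => //.
have h1 m : measurable_fun setT (EFin \o f m) by exact/measurable_EFinP.
have h2 : measurable_fun setT (EFin \o g) by exact/measurable_EFinP.
have h3 : {ae mu, forall x, setT x -> (EFin \o f m) x @[m --> \oo] --> (EFin \o g) x}.
  by apply: aeW => x _; apply: cvg_EFin; [exact: nearW|exact: fg].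
have h4 := bounded_measurable_integrable mu bM.
have h5 : {ae mu, forall x m, setT x -> (`|(EFin \o f m) x| <= (EFin \o (fun=> M)) x)%E}.
  by apply: aeW => x m _; rewrite /= lee_fin.
have [_ _] := dominated_convergence measurableT h1 h2 h3 h4 h5.
rewrite -[X in _ --> X](@fineK _ (\int[mu]_x (g x)%:E)).
  by move=> /fine_cvg.
exact: integrable_fin_num (bounded_measurable_integrable mu bg).
Qed.

Import HBNNSimple.

(** The Hahn decomposition behind [charge_integral nu] is arbitrary and cannot be compared with [mu]
    directly; the step sums see only the values of [nu]. *)
Lemma charge_integral_scale (nu : {charge set T -> \bar R})
    (mu : {finite_measure set T -> \bar R}) (c : R) (g : T -> R) :
  (forall E, measurable E -> fine (nu E) = c * fine (mu E)) ->
  bounded_measurable g -> (forall x, 0 <= g x) ->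
  charge_integral nu g = c * Rintegral mu setT g.
Proof.
move=> numu bg g0.
have mg : measurable_fun setT (EFin \o g) by apply/measurable_EFinP; exact: bg.1.
have h1 := charge_integral_step_lim (nu := nu) mg g0 bg.
have h2 := Rintegral_step_lim (mu := mu) mg g0 bg.
have {}h2 : c * step_sum mu (nnsfun_approx measurableT mg m) @[m --> \oo] -->
    c * Rintegral mu setT g.
  by apply: cvgM; [exact: cvg_cst|exact: h2].
have E : (fun m => step_sum nu (nnsfun_approx measurableT mg m)) =
    (fun m => c * step_sum mu (nnsfun_approx measurableT mg m)).
  apply/funext => m; rewrite /step_sum !fsbig_finite//= mulr_sumr.
  by apply: eq_bigr => x _; rewrite numu// mulrCA.
rewrite E in h1.
by rewrite -(cvg_lim _ h1)// -(cvg_lim _ h2).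
Qed.

End bounded_convergence.

Section circle_distance.
Variable R : realType.
Implicit Types (x y : circle R) (C : set (circle R)).

Definition circle_dist x y : R := complex.Re `|set_val x - set_val y|.

Lemma circle_distE x y : circle_dist x y = Num.sqrt (normsq (set_val x - set_val y)).
Proof. by rewrite /circle_dist normc_def. Qed.

Lemma circle_dist_ge0 x y : 0 <= circle_dist x y.
Proof. by rewrite circle_distE sqrtr_ge0. Qed.

Lemma circle_dist_triangle x y z : circle_dist x z <= circle_dist x y + circle_dist y z.
Proof.
have := ler_normD (set_val x - set_val y) (set_val y - set_val z).
rewrite addrA subrK.
rewrite /circle_dist !normc_def -rmorphD /= lecR; exact.
Qed.

Definition dist_to C x : R := inf [set circle_dist x y | y in C].

Let lb C x : has_lbound [set circle_dist x y | y in C].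
Proof. by exists 0 => _ [y _ <-]; exact: circle_dist_ge0. Qed.

Lemma dist_to_lip C x y : C !=set0 -> dist_to C x <= dist_to C y + circle_dist x y.
Proof.
move=> [c Cc]; rewrite -lerBlDr; apply: lb_le_inf; first by exists (circle_dist y c), c.
move=> _ [z Cz <-]; rewrite lerBlDr.
apply: (@le_trans _ _ (circle_dist x z)); first by apply: ge_inf => //; exists z.
by rewrite addrC circle_dist_triangle.
Qed.

Lemma continuous_dist_to C : C !=set0 -> continuous (dist_to C).
Proof.
move=> C0 x; apply/(@cvgrPdist_lt _ _ _ _ (nbhs_filter x)) => e e0.
apply/nbhs_circleP.
exists (e ^+ 2); first by rewrite exprn_gt0.
move=> y /= xy.
have dxy : circle_dist x y < e.
  by rewrite circle_distE -ltr_sqr ?nnegrE ?sqrtr_ge0 ?ltW// sqr_sqrtr// normsq_ge0.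
have dyx : circle_dist y x < e.
  by rewrite /circle_dist distrC.
have := dist_to_lip x y C0; have := dist_to_lip y x C0.
by rewrite ltr_norml => h1 h2; apply/andP; split; lra.
Qed.

Lemma dist_to_ge0 C x : C !=set0 -> 0 <= dist_to C x.
Proof.
move=> [c Cc]; apply: lb_le_inf; first by exists (circle_dist x c), c.
by move=> _ [y _ <-]; exact: circle_dist_ge0.
Qed.

Lemma dist_to_in C x : C x -> dist_to C x = 0.
Proof.
move=> Cx; apply/eqP; rewrite eq_le dist_to_ge0; last by exists x.
rewrite andbT -(_ : circle_dist x x = 0); first by apply: ge_inf => //; exists x.
by rewrite /circle_dist subrr normr0.
Qed.

Lemma dist_to_gt0 C x : C !=set0 -> closed C -> ~ C x -> 0 < dist_to C x.
Proof.
move=> [c Cc] cC Cx.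
have : nbhs x (~` C) by apply: open_nbhs_nbhs; split => //; exact: closed_openC.
move=> /nbhs_circleP[e e0 eC].
apply: (@lt_le_trans _ _ (Num.sqrt e)); first by rewrite sqrtr_gt0.
apply: lb_le_inf; first by exists (circle_dist x c), c.
move=> _ [y Cy <-]; rewrite circle_distE ler_sqrt ?normsq_ge0// leNgt.
by apply/negP => /eC.
Qed.

End circle_distance.

Section charge_uniqueness.
Variable R : realType.
Implicit Types nu : {charge set (borel (circle R)) -> \bar R}.

Lemma charge_integral_bounded_cvg nu (f : nat -> borel (circle R) -> R) g (M : R) :
  (forall m, measurable_fun setT (f m)) -> (forall m x, `|f m x| <= M) ->
  (forall x, f m x @[m --> \oo] --> g x) ->
  charge_integral nu (f m) @[m --> \oo] --> charge_integral nu g.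
Proof.
move=> mf fM fg; rewrite charge_integralE.
under eq_fun do rewrite charge_integralE.
have [_ hp] := Rintegral_bounded_cvg (jordan_pos (hahn_pair nu)) mf fM fg.
have [_ hn] := Rintegral_bounded_cvg (jordan_neg (hahn_pair nu)) mf fM fg.
exact: cvgB.
Qed.

Lemma charge_integral_indic nu (E : set (borel (circle R))) : measurable E ->
  charge_integral nu \1_E = fine (nu E).
Proof.
move=> mE; rewrite charge_integralE [RHS]jordan_fineE//.
by rewrite /Rintegral !integral_indic// !setIT.
Qed.

Lemma fine_addeB_eq (a b c d : \bar R) : a \is a fin_num -> b \is a fin_num ->
  c \is a fin_num -> d \is a fin_num ->
  (a + d = c + b)%E <-> fine a - fine b = fine c - fine d.
Proof.
case: a b c d => [a| |] [b| |] [c| |] [d| |] //= _ _ _ _; rewrite -!EFinD.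
by split=> [[e]|e]; [|congr EFin]; lra.
Qed.

(** The continuous functions [min 1 (m * dist)], with the distance to the complement of [O],
    converge boundedly to the indicator of [O]. *)
Lemma charge_eq_open nu1 nu2 (O : set (circle R)) :
  (forall u : circle R -> R, continuous u ->
    charge_integral nu1 u = charge_integral nu2 u) ->
  open O -> fine (nu1 O) = fine (nu2 O).
Proof.
move=> h oO.
have c1 : continuous (fun _ : circle R => 1 : R) by exact: cst_continuous.
have mO : measurable (O : set (borel (circle R))) by exact: sub_sigma_algebra.
(* For an empty complement the infimum in [dist_to] is over the empty set and carries no
   information; the constant 1 settles [O = setT]. *)
have [C0|C0] := pselect ((~` O) !=set0); last first.
  have -> : O = setT.
    by apply/seteqP; split => // x _; apply: contrapT => Ox; apply: C0; exists x.
  by have := h _ c1; rewrite !charge_integral_cst !mul1r.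
pose f m x := Num.min 1 (m%:R * dist_to (~` O) x).
have cf m : continuous (f m).
  move=> x; apply: (@continuous_min _ _ (fun=> 1) (fun y => m%:R * dist_to (~` O) y)).
    exact: c1.
  have cm : continuous (fun _ : circle R => m%:R : R) by exact: cst_continuous.
  exact: (continuousM (cm x) (@continuous_dist_to R _ C0 x)).
have f1 m x : `|f m x| <= 1.
  have f0 : 0 <= f m x by rewrite le_min ler01 mulr_ge0// dist_to_ge0.
  by rewrite ger0_norm// ge_min lexx.
have fO x : f m x @[m --> \oo] --> (\1_O x : R).
  have [xO|xO] := pselect (O x).
    rewrite indicE mem_set//=.
    have d0 : 0 < dist_to (~` O) x.
      by apply: dist_to_gt0 => //; exact: open_closedC.
    apply: cvg_near_cst; near=> m; apply/min_idPl.
    rewrite -ler_pdivrMr// div1r.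
    by near: m; exact: nbhs_infty_ger.
  rewrite indicE memNset//=.
  have -> : (fun m => f m x) = (fun=> 0).
    by apply/funext => m; rewrite /f dist_to_in// mulr0; apply/min_idPr.
  exact: cvg_cst.
have mf m : measurable_fun setT (f m : borel (circle R) -> R).
  by have [] := continuous_bounded_measurable (cf m).
have l1 := charge_integral_bounded_cvg (nu := nu1) mf f1 fO.
have l2 := charge_integral_bounded_cvg (nu := nu2) mf f1 fO.
rewrite -!charge_integral_indic//.
exact: (cvg_seq_eq (fun m => h _ (cf m)) l1 l2).
Unshelve. all: by end_near. Qed.

(** Uniqueness on a pi-system is a statement about positive measures, so the equality of the charges
    is rearranged as [nu1^+ + nu2^- = nu2^+ + nu1^-]. *)
Lemma charge_eq_on_continuous nu1 nu2 :
  (forall u : circle R -> R, continuous u ->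
    charge_integral nu1 u = charge_integral nu2 u) ->
  forall E, measurable E -> nu1 E = nu2 E.
Proof.
move=> h E mE.
suff : fine (nu1 E) = fine (nu2 E).
  move=> nuE; rewrite -[LHS]fineK; last exact: fin_num_measure.
  by rewrite nuE fineK//; exact: fin_num_measure.
have H1 := jordan_fineE nu1; have H2 := jordan_fineE nu2.
pose m1 := measure_add (jordan_pos (hahn_pair nu1)) (jordan_neg (hahn_pair nu2)).
pose m2 := measure_add (jordan_pos (hahn_pair nu2)) (jordan_neg (hahn_pair nu1)).
have m1E F : m1 F = (jordan_pos (hahn_pair nu1) F + jordan_neg (hahn_pair nu2) F)%E.
  exact: measure_addE.
have m2E F : m2 F = (jordan_pos (hahn_pair nu2) F + jordan_neg (hahn_pair nu1) F)%E.
  exact: measure_addE.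
have key F : measurable F -> (m1 F = m2 F <-> fine (nu1 F) = fine (nu2 F)).
  by move=> mF; rewrite m1E m2E H1// H2//; apply: fine_addeB_eq; exact: fin_num_measure.
apply/key => //.
apply: (@g_sigma_algebra_measure_unique _ R (borel (circle R)) open _ (fun=> setT)) => //.
- by move=> O oO; exact: sub_sigma_algebra.
- by move=> _; exact: openT.
- by rewrite bigcup_const.
- exact: openI.
- by move=> O oO; apply/key; [exact: sub_sigma_algebra|exact: (charge_eq_open h oO)].
- by move=> _; rewrite [X in (X < _)%E]m1E ltey_eq fin_numD !fin_num_measure.
Qed.

End charge_uniqueness.

(** * Poisson integral of the Lebesgue measure *)

Section lebesgue_poisson.
Variable R : realType.
Implicit Types (z : R[i]).
Local Open Scope complex_scope.

(* [poisson_re z t] and [poisson_im z t] are the real and imaginary parts of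
   [1 - z exp (- i t)]; the Poisson kernel is [1 + 2 d/dt arg (1 - z exp (- i t))]. *)
Definition poisson_re z (t : R) : R :=
  1 - (complex.Re z * cos t + complex.Im z * sin t).
Definition poisson_im z (t : R) : R :=
  complex.Re z * sin t - complex.Im z * cos t.

(** Positivity lets [atan] of the quotient in [poisson_primitive] be a smooth argument of
    [1 - z exp (- i t)], with no branch cut to cross. *)
Lemma poisson_re_gt0 z t : `|z| < 1 -> 0 < poisson_re z t.
Proof.
rewrite normr_lt1_normsq /normsq /poisson_re; case: z => c f /= h.
have := cos2Dsin2 t; set C := cos t; set S := sin t => h2.
rewrite subr_gt0.
have := sqr_ge0 (c - C); have := sqr_ge0 (f - S).
rewrite !sqrrB; nra.
Qed.

(** Real part of [(1 + w) / (1 - w) = 2 / (1 - w) - 1] with [w = z exp (- i t)]. *)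
Lemma pker_expi z t : `|z| < 1 ->
  pker z (expi t) =
  2 * (poisson_re z t / (poisson_re z t ^+ 2 + poisson_im z t ^+ 2)) - 1.
Proof.
move=> z1; have a0 := poisson_re_gt0 t z1; rewrite pkerE//.
have := circle_sub_neq0 (expi t) z1; rewrite -normsq_eq0 expiE.
move: a0; rewrite /poisson_re /poisson_im /normsq.
case: z {z1} => c f /=.
have := cos2Dsin2 t; set C := cos t; set S := sin t => h2 a0 n0.
have e : (1 - (c * C + f * S)) ^+ 2 + (c * S - f * C) ^+ 2 =
    (C - c) ^+ 2 + (S - f) ^+ 2.
  have -> : (1 - (c * C + f * S)) ^+ 2 + (c * S - f * C) ^+ 2 =
    1 - 2 * (c * C + f * S) + (c ^+ 2 + f ^+ 2) * (C ^+ 2 + S ^+ 2) by ring.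
  by rewrite h2; lra.
rewrite e; apply: (mulIf n0); rewrite mulfVK// mulrBl mulrA mulfVK// mul1r.
lra.
Qed.

Definition poisson_primitive z (t : R) : R :=
  t + 2 * atan (poisson_im z t / poisson_re z t).

(** With A and B for [poisson_re] and [poisson_im], A' = B and B' = 1 - A, so the arctangent of B /
    A has derivative A / (A^2 + B^2) - 1. *)
Lemma is_derive_poisson z (t : R) : `|z| < 1 ->
  is_derive t 1 (poisson_primitive z) (pker z (expi t)).
Proof.
move=> z1; have a0 := poisson_re_gt0 t z1.
have dA : is_derive t 1 (poisson_re z) (poisson_im z t).
  apply: trigger_derive; rewrite /poisson_im /GRing.scale /=; ring.
have dB : is_derive t 1 (poisson_im z) (1 - poisson_re z t).
  apply: trigger_derive; rewrite /poisson_re /GRing.scale /=; ring.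
have dV := is_deriveV (lt0r_neq0 a0) dA.
pose q s := poisson_im z s / poisson_re z s.
have dQ : is_derive t 1 q _ := is_deriveM dB dV.
have dT := @is_derive1_comp R atan q t _ _ (is_derive1_atan (q t)) dQ.
have dF := is_deriveD (is_derive_id t 1) (is_deriveZ 2 dT).
apply: (is_derive_eq dF).
rewrite pker_expi// /q /GRing.scale /=.
move: (poisson_re z t) (poisson_im z t) a0 => A B A0; field.
by rewrite !gt_eqF// ltr_wpDr ?sqr_ge0// exprn_gt0.
Qed.

(** The arctangent term of the primitive is 2 pi-periodic, so over one turn the primitive grows by
    exactly 2 pi, the normalizing constant of the uniform law. *)
Lemma Rintegral_circle_lebesgue_pker z : `|z| < 1 ->
  Rintegral (circle_lebesgue R) setT (pker z) = 1.
Proof.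
move=> z1.
have mg : measurable_fun setT (EFin \o (pker z : borel (circle R) -> R)).
  by apply/measurable_EFinP; exact: (bounded_measurable_pker z1).1.
have cF : continuous (poisson_primitive z).
  move=> t; apply/differentiable_continuous/derivable1_diffP.
  by case: (is_derive_poisson t z1).
rewrite /Rintegral /circle_lebesgue /distribution.
rewrite ge0_integral_pushforward//=.
rewrite preimage_setT integral_uniform/=.
rewrite (@continuous_FTC2 _ _ (poisson_primitive z)).
- rewrite -EFinB -EFinM /= subr0 /poisson_primitive /poisson_im /poisson_re.
  rewrite cos0 sin0 mulr_natl cos2pi sin2pi add0r addrK mulVf//.
  by rewrite mulrn_eq0 /= gt_eqF ?pi_gt0.
- exact: twopi_gt0.
- apply: continuous_subspaceT => t.
  apply: (@continuous_comp _ _ _ (@expi R) (pker z)); first exact: continuous_expi.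
  by have [c _] := continuous_herglotz_kernel z1; exact: c.
- split; first by move=> t _; case: (is_derive_poisson t z1).
    by apply: cvg_at_right_filter; exact: cF.
  by apply: cvg_at_left_filter; exact: cF.
- by move=> t _; rewrite derive1E; case: (is_derive_poisson t z1).
- by apply: (measurableT_comp mg); exact: measurable_expi.
- by move=> t; rewrite lee_fin pker_ge0.
- by move=> t _; rewrite lee_fin pker_ge0.
Qed.

Lemma mxint_mxlebesgue_pker n z : `|z| < 1 -> mxint (mxlebesgue R n) (pker z) = 1%:M.
Proof.
move=> z1; apply/matrixP => i j; rewrite !mxE.
have bp := bounded_measurable_pker z1.
have p0 (x : borel (circle R)) : 0 <= pker z x by exact: pker_ge0.
rewrite (@charge_integral_scale _ _ R (mxmeas_Re (mxlebesgue R n) i j)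
  (circle_lebesgue R) (i == j)%:R _ _ bp p0); last first.
  by move=> E mE; rewrite /= mxE; case: eqP => _; rewrite ?mul1r ?mul0r.
rewrite (@charge_integral_scale _ _ R (mxmeas_Im (mxlebesgue R n) i j)
  (circle_lebesgue R) 0 _ _ bp p0); last first.
  by move=> E mE; rewrite /= mxE mul0r; case: eqP.
rewrite Rintegral_circle_lebesgue_pker// mul0r mulr1.
by case: eqP.
Qed.

End lebesgue_poisson.

(** * Matrix Cayley transform and contractions *)

Section entrywise_convergence.
Context (R : realType) (I : Type) (F : set_system I) {FF : Filter F}.
Local Open Scope complex_scope.
Local Open Scope sesquilinear_scope.

(** Entrywise convergence reduces limits of products, determinants and adjugates to scalar limit
    laws. *)
Definition mxcvg m n (f : I -> 'M[R[i]]_(m, n)) (M : 'M[R[i]]_(m, n)) :=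
  forall i j, f x i j @[x --> F] --> M i j.

Lemma mxcvg_cst m n (M : 'M[R[i]]_(m, n)) : mxcvg (fun=> M) M.
Proof. by move=> i j; exact: cvg_cst. Qed.

Lemma mxcvgD m n (f g : I -> 'M[R[i]]_(m, n)) M N :
  mxcvg f M -> mxcvg g N -> mxcvg (fun x => f x + g x) (M + N).
Proof.
move=> fM gN i j; rewrite mxE; under eq_fun do rewrite mxE.
exact: (cvgD (fM i j) (gN i j)).
Qed.

Lemma mxcvgZ m n (c : I -> R[i]) (f : I -> 'M[R[i]]_(m, n)) (a : R[i]) M :
  c @ F --> a -> mxcvg f M -> mxcvg (fun x => c x *: f x) (a *: M).
Proof.
move=> ca fM i j; rewrite mxE; under eq_fun do rewrite mxE.
exact: (cvgM ca (fM i j)).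
Qed.

Lemma mxcvgN m n (f : I -> 'M[R[i]]_(m, n)) M :
  mxcvg f M -> mxcvg (fun x => - f x) (- M).
Proof.
move=> fM i j; rewrite mxE; under eq_fun do rewrite mxE.
exact: (cvgN (fM i j)).
Qed.

Lemma mxcvgM m n p (f : I -> 'M[R[i]]_(m, n)) (g : I -> 'M[R[i]]_(n, p)) M N :
  mxcvg f M -> mxcvg g N -> mxcvg (fun x => f x *m g x) (M *m N).
Proof.
move=> fM gN i j; rewrite mxE; under eq_fun do rewrite mxE.
by apply: cvg_bigsum => k; exact: (cvgM (fM i k) (gN k j)).
Qed.

Lemma cvg_bigprod (J : Type) (s : seq J) (f : J -> I -> R[i]) (a : J -> R[i]) :
  (forall j, f j @ F --> a j) ->
  (\prod_(j <- s) f j x) @[x --> F] --> \prod_(j <- s) a j.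
Proof.
move=> fa; elim: s => [|j s IH].
  by under eq_fun do rewrite big_nil; rewrite big_nil; exact: cvg_cst.
under eq_fun do rewrite big_cons; rewrite big_cons.
exact: (cvgM (fa j) IH).
Qed.

Lemma mxcvg_det n (f : I -> 'M[R[i]]_n) M :
  mxcvg f M -> \det (f x) @[x --> F] --> \det M.
Proof.
move=> fM; rewrite /determinant; apply: cvg_bigsum => s.
apply: (cvgM (cvg_cst _)); apply: cvg_bigprod => i; exact: fM.
Qed.

Lemma mxcvg_adj n (f : I -> 'M[R[i]]_n) M :
  mxcvg f M -> mxcvg (fun x => \adj (f x)) (\adj M).
Proof.
move=> fM i j; rewrite mxE; under eq_fun do rewrite mxE.
apply: (cvgM (cvg_cst _)); apply: mxcvg_det => k l; rewrite !mxE.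
by under eq_fun do rewrite !mxE; exact: fM.
Qed.

(** Cramer's formula. Invertibility is asked at every point because [invmx] is defined by cases. *)
Lemma mxcvg_inv n (f : I -> 'M[R[i]]_n) M :
  (forall x, f x \in unitmx) -> M \in unitmx ->
  mxcvg f M -> mxcvg (fun x => invmx (f x)) (invmx M).
Proof.
move=> fu Mu fM; rewrite /invmx Mu.
have -> : (fun x => if f x \in unitmx then (\det (f x))^-1 *: \adj (f x) else f x) =
    (fun x => (\det (f x))^-1 *: \adj (f x)).
  by apply/funext => x; rewrite fu.
apply: mxcvgZ; last exact: mxcvg_adj.
apply: cvgV; last exact: mxcvg_det.
by move: Mu; rewrite unitmxE unitfE.
Qed.

Lemma cvg_conj (f : I -> R[i]) z :
  f @ F --> z -> Num.conj (f x) @[x --> F] --> Num.conj z.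
Proof.
move=> fz.
rewrite conj_complexE; under eq_fun do rewrite conj_complexE.
by apply: cvg_complex; [exact: cvg_Re|apply: cvgN; exact: cvg_Im].
Qed.

Lemma mxcvg_conjT m n (f : I -> 'M[R[i]]_(m, n)) M :
  mxcvg f M -> mxcvg (fun x => (f x)^t*) (M^t*).
Proof.
move=> fM i j; rewrite !mxE; under eq_fun do rewrite !mxE.
exact: (cvg_conj (fM j i)).
Qed.

Lemma mxcvg_mxRe n (f : I -> 'M[R[i]]_n) M :
  mxcvg f M -> mxcvg (fun x => mxRe (f x)) (mxRe M).
Proof.
move=> fM; apply: mxcvgZ; first exact: cvg_cst.
exact: (mxcvgD fM (mxcvg_conjT fM)).
Qed.

End entrywise_convergence.

Section matrix_cayley.
Variables (R : realType) (n : nat).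
Implicit Types X M : 'M[R[i]]_n.

(** At [X = Theta z *m A^t*] this is [cayley Theta A z] by conversion. *)
Definition mcayley X := (1%:M + X) *m invmx (1%:M - X).

Lemma mxcvg_mcayley (I : Type) (F : set_system I) (FF : Filter F)
    (f : I -> 'M[R[i]]_n) M :
  (forall x, 1%:M - f x \in unitmx) -> 1%:M - M \in unitmx ->
  mxcvg F f M -> mxcvg F (fun x => mcayley (f x)) (mcayley M).
Proof.
move=> fu Mu fM; have c1 : mxcvg F (fun=> 1%:M : 'M[R[i]]_n) 1%:M by exact: mxcvg_cst.
apply: (mxcvgM (mxcvgD c1 fM)).
exact: (mxcvg_inv fu Mu (mxcvgD c1 (mxcvgN fM))).
Qed.

Lemma sqr_unitmx X : 1%:M - X \in unitmx -> 1%:M + X \in unitmx ->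
  1%:M - X *m X \in unitmx.
Proof.
move=> u1 u2; have -> : 1%:M - X *m X = (1%:M - X) *m (1%:M + X).
  rewrite mulmxDr mulmx1 mulmxBl mul1mx.
  by rewrite addrA subrK.
by rewrite unitmx_mul u1.
Qed.

(** Multiplied on the right by [1 - X^2], factored in either order, the claim becomes
    [(1 + X)^2 + (1 - X)^2 = 2 (1 + X^2)]. *)
Lemma mcayleyDN X : 1%:M - X \in unitmx -> 1%:M + X \in unitmx ->
  mcayley X + mcayley (- X) = mcayley (X *m X) + mcayley (X *m X).
Proof.
move=> u1 u2; have u3 := sqr_unitmx u1 u2.
have e1 : 1%:M - X *m X = (1%:M - X) *m (1%:M + X).
  by rewrite mulmxDr mulmx1 mulmxBl mul1mx addrA subrK.
have e2 : 1%:M - X *m X = (1%:M + X) *m (1%:M - X).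
  by rewrite mulmxBr mulmx1 mulmxDl mul1mx opprD addrA addrK.
apply: (can_inj (mulmxK u3)).
have h1 : mcayley X *m (1%:M - X *m X) = (1%:M + X) *m (1%:M + X).
  by rewrite /mcayley e1 mulmxA mulmxKV.
have h2 : mcayley (- X) *m (1%:M - X *m X) = (1%:M - X) *m (1%:M - X).
  by rewrite /mcayley e2 opprK mulmxA mulmxKV.
have h3 : mcayley (X *m X) *m (1%:M - X *m X) = 1%:M + X *m X.
  by rewrite /mcayley mulmxKV.
rewrite [LHS]mulmxDl [RHS]mulmxDl h1 h2 h3 !mulmxDr !mulmxDl !mulmx1 !mul1mx.
rewrite mulmxN mulNmx opprK.
move: (X *m X) (1%:M : 'M[R[i]]_n) => Y O.
by apply/matrixP => i j; rewrite !mxE; ring.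
Qed.

Lemma mcayley0 : mcayley 0 = 1%:M.
Proof. by rewrite /mcayley addr0 subr0 invmx1 mulmx1. Qed.

End matrix_cayley.

Section contractions.
Variables (R : realType) (n : nat).
Implicit Types (A M : 'M[R[i]]_n) (x : 'cV[R[i]]_n).
Local Open Scope complex_scope.
Local Open Scope sesquilinear_scope.

Lemma enormE x : enorm x = Num.sqrt (\sum_(i < n) normsq (x i 0)).
Proof. by []. Qed.

Lemma enorm_ge0 x : 0 <= enorm x.
Proof. exact: sqrtr_ge0. Qed.

Lemma enorm0 : enorm (0 : 'cV[R[i]]_n) = 0.
Proof.
rewrite enormE big1 ?sqrtr0// => i _.
by rewrite mxE /normsq /= expr0n addr0.
Qed.

Lemma sum_normsq_ge0 x : 0 <= \sum_(i < n) normsq (x i 0).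
Proof. by apply: sumr_ge0 => i _; exact: normsq_ge0. Qed.

Lemma enormZ (c : R) x : enorm (c%:C *: x) = `|c| * enorm x.
Proof.
rewrite !enormE -sqrtr_sqr -sqrtrM ?sqr_ge0// mulr_sumr.
congr (Num.sqrt _); apply: eq_bigr => i _; rewrite mxE /normsq.
by case: (x i 0) => a b; rewrite realC_mul_complex /= !exprMn mulrDr.
Qed.

Lemma enorm_eq0 x : enorm x = 0 -> x = 0.
Proof.
move=> /eqP; rewrite enormE sqrtr_eq0 => s0.
have : \sum_(i < n) normsq (x i 0) == 0 by rewrite eq_le s0 sum_normsq_ge0.
rewrite psumr_eq0 => [/allP h|i _]; last exact: normsq_ge0.
apply/matrixP => i j; rewrite ord1 mxE; apply/eqP.
by have := h i (mem_index_enum _); rewrite normsq_eq0.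
Qed.

Lemma entry_le_enorm x i : normsq (x i 0) <= enorm x ^+ 2.
Proof.
rewrite enormE sqr_sqrtr ?sum_normsq_ge0// (bigD1 i)//= lerDl.
by apply: sumr_ge0 => j _; exact: normsq_ge0.
Qed.

Lemma sum_normsqE x : (x^t* *m x) 0 0 = (\sum_(i < n) normsq (x i 0))%:C.
Proof.
rewrite mxE raddf_sum; apply: eq_bigr => i _; rewrite !mxE.
rewrite conj_complexE /normsq; case: (x i 0) => a b /=; simpc.
by rewrite !expr2 [b * a]mulrC subrr.
Qed.

(** Equivalent to [opnorm A <= 1] by the two lemmas below, and stable under products with no
    supremum involved. *)
Definition contraction A := forall x, enorm (A *m x) <= enorm x.

(** A [sup] is informative only for a bounded set; entries of a vector of norm at most 1 have
    modulus at most 1, so row sums of moduli give a bound. *)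
Lemma has_ubound_opnorm A :
  has_ubound [set enorm (A *m x) | x in [set x : 'cV[R[i]]_n | enorm x <= 1]].
Proof.
exists (Num.sqrt (\sum_(i < n) (\sum_(j < n) Num.sqrt (normsq (A i j))) ^+ 2)).
move=> _ [x /= x1 <-]; rewrite enormE ler_wsqrtr//.
apply: ler_sum => i _; rewrite -normr_le_normsq; last first.
  by apply: sumr_ge0 => j _; exact: sqrtr_ge0.
rewrite mxE; apply: le_trans (ler_norm_sum _ _ _) _.
rewrite raddf_sum; apply: ler_sum => j _; rewrite normrM.
have x1' : `|x j 0| <= 1.
  rewrite (@normr_le_normsq _ _ 1)// expr1n; apply: le_trans (entry_le_enorm x j) _.
  by rewrite exprn_ile1// enorm_ge0.
apply: le_trans (ler_wpM2l (normr_ge0 _) x1') _.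
by rewrite mulr1 normc_def.
Qed.

Lemma opnorm_contraction A : opnorm A <= 1 -> contraction A.
Proof.
move=> A1 x; have unit_case y : enorm y <= 1 -> enorm (A *m y) <= 1.
  move=> y1; apply: le_trans A1; apply: ub_le_sup; first exact: has_ubound_opnorm.
  by exists y.
have [x0|x0] := eqVneq (enorm x) 0.
  by rewrite (enorm_eq0 x0) mulmx0 -(enorm_eq0 x0).
have xp : 0 < enorm x by rewrite lt_def x0 enorm_ge0.
have := unit_case ((enorm x)^-1%:C *: x).
rewrite -scalemxAr !enormZ ger0_norm ?invr_ge0 ?enorm_ge0// mulVf// lexx.
by move=> /(_ isT); rewrite mulrC ler_pdivrMr// mul1r.
Qed.

Lemma contraction_opnorm A : contraction A -> opnorm A <= 1.
Proof.
move=> cA; apply: ge_sup.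
  by exists (enorm (A *m 0)), 0 => //=; rewrite enorm0.
by move=> _ [x /= x1 <-]; exact: le_trans (cA x) x1.
Qed.

Lemma contractionM A M : contraction A -> contraction M -> contraction (A *m M).
Proof. by move=> cA cM x; rewrite -mulmxA; exact: le_trans (cA _) (cM x). Qed.

Lemma contractionZ (s : R) A : 0 <= s -> s <= 1 -> contraction A ->
  contraction (s%:C *: A).
Proof.
move=> s0 s1 cA x; rewrite -scalemxAl enormZ ger0_norm//.
by apply: le_trans (cA x); rewrite ler_piMl// enorm_ge0.
Qed.

Lemma contraction_unitary A : A \is unitarymx -> contraction A.
Proof.
move=> /unitarymxP uA x; have uA' : A^t* *m A = 1%:M by exact: mulmx1C.
rewrite le_eqVlt; apply/orP; left; apply/eqP; rewrite !enormE.
congr (Num.sqrt _); have : (((A *m x)^t* *m (A *m x)) 0 0) = ((x^t* *m x) 0 0).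
  by rewrite trmx_mul map_mxM mulmxA -(mulmxA (x^t*)) uA' mulmx1.
by rewrite !sum_normsqE => /(congr1 (@complex.Re R)).
Qed.

Lemma contraction_entry A i j : contraction A -> `|A i j| <= 1.
Proof.
move=> cA; have := cA (delta_mx j 0).
have -> : enorm (delta_mx j 0 : 'cV[R[i]]_n) = 1.
  rewrite enormE (bigD1 j)//= big1 => [|k kj].
    by rewrite mxE !eqxx /normsq /= expr1n expr0n addr0 addr0 sqrtr1.
  by rewrite mxE (negbTE kj) /normsq /= expr0n addr0.
move=> h; have := entry_le_enorm (A *m delta_mx j 0) i.
rewrite -colE mxE => h2.
have {h2} : normsq (A i j) <= 1.
  by apply: le_trans h2 _; rewrite exprn_ile1// ?enorm_ge0// colE.
by rewrite (@normr_le_normsq _ _ 1)// expr1n.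
Qed.

End contractions.

(** * Poisson integrals of Clark measures *)

Section clark_measures.
Variables (R : realType) (n : nat) (Theta : R[i] -> 'M[R[i]]_n).
Implicit Types (Om : pos_mxmeasure R n) (A M : 'M[R[i]]_n) (z : R[i]).
Local Open Scope complex_scope.
Local Open Scope sesquilinear_scope.

(** A boolean choice of real or imaginary part, so that each statement about real integrals of
    entries is proved once for both. *)
Definition cpart (b : bool) (w : R[i]) : R :=
  if b then complex.Im w else complex.Re w.

Lemma cpartD b w1 w2 : cpart b (w1 + w2) = cpart b w1 + cpart b w2.
Proof. by case: b; rewrite /cpart raddfD. Qed.

Lemma cpart_realC b (c : R) w : cpart b (c%:C * w) = c * cpart b w.
Proof. by case: b; case: w => p q; rewrite realC_mul_complex. Qed.

Lemma cvg_cpart b (I : Type) (F : set_system I) (FF : Filter F) (f : I -> R[i]) w :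
  f @ F --> w -> cpart b (f x) @[x --> F] --> cpart b w.
Proof. by case: b => fw; [exact: cvg_Im|exact: cvg_Re]. Qed.

Lemma cvg_cpart_mcayley b i j (I : Type) (F : set_system I) (FF : Filter F)
    (f : I -> 'M[R[i]]_n) M :
  (forall x, 1%:M - f x \in unitmx) -> 1%:M - M \in unitmx -> mxcvg F f M ->
  cpart b (mxRe (mcayley (f x)) i j) @[x --> F] --> cpart b (mxRe (mcayley M) i j).
Proof.
move=> fu Mu fM; have c := mxcvg_mxRe (mxcvg_mcayley FF fu Mu fM).
exact: (@cvg_cpart b _ _ FF (fun x => mxRe (mcayley (f x)) i j) _ (c FF i j)).
Qed.

Lemma clark_mxint A Om z : is_clark_measure Theta A Om -> `|z| < 1 ->
  mxRe (mcayley (Theta z *m A^t*)) = mxint Om (pker z).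
Proof. by move=> cOm z1; rewrite -mxRe_mxint_herglotz// -cOm. Qed.

Lemma mxRe1 : mxRe 1%:M = 1%:M :> 'M[R[i]]_n.
Proof.
rewrite /mxRe trmx1 map_mx1 -[in LHS](scale1r 1%:M) -scalerDl scalerA.
by rewrite -[1 + 1]/(2%:R) mulVf ?scale1r// pnatr_eq0.
Qed.

(** The Herglotz identity at [z = 0], where the Poisson kernel is constantly 1 and the Cayley
    transform is the identity. *)
Lemma clark_setT A Om : Theta 0 = 0 -> is_clark_measure Theta A Om ->
  Om setT = 1%:M.
Proof.
move=> T0 /clark_mxint /(_ (_ : `|0| < 1)); rewrite normr0 ltr01 => /(_ isT).
rewrite T0 mul0mx mcayley0 mxRe1 => ->.
rewrite -[LHS]scale1r -(mxint_cst Om 1); congr (mxint _ _).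
by apply/funext => x; rewrite pker0.
Qed.

Lemma quad_form1_gt0 (x : 'cV[R[i]]_n) : x != 0 -> 0 < complex.Re (quad_form 1%:M x).
Proof.
move=> x0; rewrite /quad_form mulmx1 sum_normsqE /= lt_def sum_normsq_ge0 andbT.
apply: contraNneq x0 => s0; apply/eqP/enorm_eq0.
by rewrite enormE s0 sqrtr0.
Qed.

(* When [1 - X] is singular, [invmx] returns [1 - X] itself, and the quadratic form of
   [Re ((1 + X)(1 - X))] vanishes on the kernel of [1 - X], whereas that of the Poisson
   integral of a positive measure of total mass [1] does not. *)
Lemma clark_unitmx A Om z : Theta 0 = 0 -> is_clark_measure Theta A Om -> `|z| < 1 ->
  1%:M - Theta z *m A^t* \in unitmx.
Proof.
move=> T0 cOm z1; set X := Theta z *m A^t*.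
apply: contraT => nu.
have [v v0 vX] : exists2 v : 'rV_n, v != 0 & v *m (1%:M - X)^T = 0.
  by apply/det0P/eqP; move: nu; rewrite unitmxE unitfE negbK det_tr => /eqP.
pose x := v^T.
have x0 : x != 0.
  by apply: contraNneq v0 => xv0; rewrite -[v]trmxK -/x xv0 trmx0.
have Xx : (1%:M - X) *m x = 0 by rewrite -[LHS]trmxK trmx_mul trmxK vX trmx0.
have q0 : quad_form (mxRe (mcayley X)) x = 0.
  have xX : x^t* *m (1%:M - X)^t* = 0 by rewrite -map_mxM -trmx_mul Xx trmx0 map_mx0.
  rewrite /mxRe quad_formZ quad_formD /mcayley /quad_form {1}/invmx (negbTE nu).
  rewrite {1}/invmx (negbTE nu) trmx_mul map_mxM.
  rewrite !mulmxA xX -!mulmxA Xx !(mulmx0, mul0mx) mxE.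
  by rewrite !addr0 mulr0.
have bp := bounded_measurable_pker z1.
(* The lower bound of the kernel from [pker_ge]: positivity of the integral of [pker z - c] yields
   [0 >= c * |x|^2], a contradiction. *)
pose c := (1 - normsq z) / 4.
have c0 : 0 < c by rewrite divr_gt0// subr_gt0 -normr_lt1_normsq.
have bc (a : R) : bounded_measurable (fun _ : borel (circle R) => a).
  by split; [exact: measurable_cst|exists `|a|].
have bpc : bounded_measurable (fun y : borel (circle R) => pker z y + - c).
  split; first by apply: measurable_funD; [exact: bp.1|exact: (bc _).1].
  have [M hM] := bp.2; exists (M + `|c|) => y.
  by rewrite (le_trans (ler_normD _ _))// normrN lerD2r.
have := psdmx_quad_form x (mxint_psd Om bpc _) => -[|_].
  by move=> y; rewrite subr_ge0 pker_ge.
rewrite mxintD// quad_formD -(clark_mxint cOm z1) -/X q0 add0r.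
rewrite mxint_cst (clark_setT T0 cOm) quad_formZ.
rewrite -[complex.Re _]/(cpart false _) cpart_realC mulNr oppr_ge0 leNgt mulr_gt0//.
exact: quad_form1_gt0.
Qed.

(** The constant depends on [z] only, so it dominates for all scaled unitaries at once. *)
Lemma clark_bound z : Theta 0 = 0 -> `|z| < 1 ->
  exists M : R, forall A Om, is_clark_measure Theta A Om ->
    forall b i j, `|cpart b (mxRe (mcayley (Theta z *m A^t*)) i j)| <= M.
Proof.
move=> T0 z1; have [_ [M hM]] := bounded_measurable_pker z1.
exists (2 * M) => A' Om' cOm b i j; rewrite (clark_mxint cOm z1).
have [h1 h2] := mxint_bound (clark_setT T0 cOm) (bounded_measurable_pker z1) hM i j.
by case: b.
Qed.

End clark_measures.

(** * Averages over the unitary group *)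

Section haar_average.
Variables (R : realType) (n : nat) (H : probability (borel (unitary R n)) R).
Hypothesis H_haar : is_haar H.
Implicit Types (U V : unitary R n) (X : 'M[R[i]]_n).
Local Open Scope complex_scope.
Local Open Scope sesquilinear_scope.

Lemma cvg_unitary_entry U : mxcvg (nbhs U) (fun V : unitary R n => set_val V) (set_val U).
Proof.
move=> i j; have c : (set_val : unitary R n -> 'M[R[i]]_n) @ nbhs U --> set_val U.
  exact: initial_continuous.
exact: (@cvg_mx_entry _ _ _ _ _ (nbhs_filter U) _ _ i j c).
Qed.

Lemma mxcvg_cvg (I : Type) (F : set_system I) (FF : Filter F)
    (f : I -> 'M[R[i]]_n) M : mxcvg F f M -> f @ F --> M.
Proof.
move=> fM A [P nP PA].
have : \forall x \near F, forall i j, P i j (f x i j).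
  by apply: filter_forall => i; apply: filter_forall => j; exact: fM (nP i j).
by apply: filterS => x h; exact: PA.
Qed.

Lemma continuous_umul V : continuous (umul V : unitary R n -> unitary R n).
Proof.
apply: continuous_comp_initial => U.
apply: (mxcvg_cvg (nbhs_filter U)).
have c : mxcvg (nbhs U) (fun=> set_val V) (set_val V) by exact: mxcvg_cst.
exact: (mxcvgM c (@cvg_unitary_entry U)).
Qed.

Lemma measurable_umul V : measurable_fun setT (umul V : borel (unitary R n) -> borel (unitary R n)).
Proof.
apply: (@measurability _ _ (borel (unitary R n)) (borel (unitary R n)) _ _ open) => //.
move=> _ [B oB <-]; rewrite setTI; apply: sub_sigma_algebra.
by move/continuousP: (@continuous_umul V); exact.
Qed.

Lemma Rintegral_probability_cst (c : R) : Rintegral H setT (fun=> c) = c.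
Proof.
transitivity (c * fine (H setT)); first exact: Rintegral_cst.
by rewrite probability_setT mulr1.
Qed.

Lemma Rintegral_haar V (f : borel (unitary R n) -> R) : bounded_measurable f ->
  Rintegral H setT (fun U : borel (unitary R n) => f (umul V U)) = Rintegral H setT f.
Proof.
move=> bf.
have mf : measurable_fun setT (EFin \o f) by apply/measurable_EFinP; exact: bf.1.
rewrite /Rintegral; congr fine.
have bfV : bounded_measurable (fun U : borel (unitary R n) => f (umul V U)).
  split; last by have [_ [M fM]] := bf; exists M => U; exact: fM.
  by apply: (measurableT_comp bf.1); exact: measurable_umul.
transitivity (\int[pushforward H (umul V : borel (unitary R n) -> borel (unitary R n))]_U (f U)%:E)%E.
  rewrite integral_pushforward//; first exact: measurable_umul.
  rewrite preimage_setT; exact: (bounded_measurable_integrable H bfV).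
apply: eq_measure_integral => [|mV A mA _]; first exact: measurable_umul.
exact: (H_haar V mA).
Qed.

Lemma Rintegral_haar_avg V (f g : borel (unitary R n) -> R) : bounded_measurable f ->
  (forall U, g U = 2^-1 * (f U + f (umul V U))) ->
  Rintegral H setT g = Rintegral H setT f.
Proof.
move=> bf gE; have [mf [M fM]] := bf.
have bfV : bounded_measurable (fun U : borel (unitary R n) => f (umul V U)).
  split; last by exists M => U; exact: fM.
  by apply: (measurableT_comp mf); exact: measurable_umul.
have bs : bounded_measurable (fun U : borel (unitary R n) => f U + f (umul V U)).
  split; first exact: (measurable_funD mf bfV.1).
  by exists (M + M) => U; apply: le_trans (ler_normD _ _) _; apply: lerD; exact: fM.
have -> : g = (fun U : borel (unitary R n) => 2^-1 * (f U + f (umul V U))).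
  exact/funext.
rewrite (RintegralZl _ measurableT (bounded_measurable_integrable H bs)).
rewrite (RintegralD measurableT (bounded_measurable_integrable H bf)
  (bounded_measurable_integrable H bfV)) (Rintegral_haar V bf).
move: (Rintegral _ _ _) => a.
by field.
Qed.

Lemma scalar_unitary_subproof (w : circle R) :
  ((set_val w)%:M : 'M[R[i]]_n) \in [set U : 'M[R[i]]_n | U \is unitarymx].
Proof.
rewrite inE /=; apply/unitarymxP; rewrite tr_scalar_mx map_scalar_mx /=.
by rewrite -scalar_mxM -normCK normr_circle expr1n.
Qed.

Definition scalar_unitary (w : circle R) : unitary R n :=
  exist _ (set_val w)%:M (scalar_unitary_subproof w).

(* The power [X ^ (2 ^ k)] of [X = B U^*], for which MathComp's [^+] would need [0 < n]. *)
Fixpoint sqr_iter (B : 'M[R[i]]_n) k (U : unitary R n) : 'M[R[i]]_n :=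
  if k is k'.+1 then sqr_iter B k' U *m sqr_iter B k' U else B *m (set_val U)^t*.

Lemma sqr_iter_scalar B k w U : sqr_iter B k (umul (scalar_unitary w) U) =
  (Num.conj (set_val w)) ^+ (2 ^ k) *: sqr_iter B k U.
Proof.
elim: k => [|k /= ->]; last first.
  by rewrite -scalemxAl -scalemxAr scalerA -exprD addnn -mul2n expnS.
have E : set_val (umul (scalar_unitary w) U) = set_val w *: set_val U.
  by rewrite -mul_scalar_mx.
by rewrite /= E expr1 linearZ /= map_mxZ /= -scalemxAr.
Qed.

(** [V] must not depend on [U], so that the sign change is a single left translation, under which
    the Haar measure is invariant. *)
Lemma sqr_iter_neg B k : exists V, forall U, sqr_iter B k (umul V U) = - sqr_iter B k U.
Proof.
(* The adjoint conjugates the scalar and squaring raises it to the power [2 ^ k], which turns this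
   root into [exp (i pi) = -1]. *)
exists (scalar_unitary (expi (- (pi / (2 ^ k)%:R)))) => U.
rewrite sqr_iter_scalar.
have -> : Num.conj (set_val (expi (- (pi / (2 ^ k)%:R)))) =
    set_val (expi (pi / (2 ^ k)%:R) : circle R).
  by rewrite conj_complexE !expiE /= cosN sinN opprK.
rewrite -expi_natmul mulrC mulfVK ?pnatr_eq0 ?expn_eq0//.
have -> : set_val (expi (pi : R)) = -1.
  by rewrite expiE cospi sinpi; apply/eqP; rewrite eq_complex /= oppr0 !eqxx.
by rewrite scaleN1r.
Qed.

Lemma mxcvg_sqr_iter B k U : mxcvg (nbhs U) (sqr_iter B k) (sqr_iter B k U).
Proof.
elim: k => [|k IH] /=.
  have c : mxcvg (nbhs U) (fun=> B) B by exact: mxcvg_cst.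
  exact: (mxcvgM c (mxcvg_conjT (@cvg_unitary_entry U))).
exact: (mxcvgM IH IH).
Qed.

(** In [1 - X^2 = (1 - X)(1 + X)] the second factor is [1 - X] taken at the translated unitary
    [umul V U], hence also invertible. *)
Lemma sqr_iter_unitmx B k : (forall U, 1%:M - sqr_iter B 0 U \in unitmx) ->
  forall U, 1%:M - sqr_iter B k U \in unitmx.
Proof.
move=> u0; elim: k => [//|k IH] U.
have [V VN] := sqr_iter_neg B k.
apply: sqr_unitmx; first exact: IH.
by have := IH (umul V U); rewrite VN opprK.
Qed.

Definition clark_part B k b i j (U : borel (unitary R n)) : R :=
  cpart b (mxRe (mcayley (sqr_iter B k U)) i j).

Lemma mxReD X Y : mxRe (X + Y) = mxRe X + mxRe Y :> 'M[R[i]]_n.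
Proof. by rewrite /mxRe [(_ + _)^T]linearD /= map_mxD addrACA scalerDr. Qed.

Lemma clark_partS B k b i j U V : (forall U, 1%:M - sqr_iter B 0 U \in unitmx) ->
  sqr_iter B k (umul V U) = - sqr_iter B k U ->
  clark_part B k.+1 b i j U =
  2^-1 * (clark_part B k b i j U + clark_part B k b i j (umul V U)).
Proof.
move=> u0 VN; have u1 := sqr_iter_unitmx k u0 U.
have u2 : 1%:M + sqr_iter B k U \in unitmx.
  by have := sqr_iter_unitmx k u0 (umul V U); rewrite VN opprK.
(* Destructuring the existential makes [f] an opaque variable, known only through [fE] and its
   additivity. *)
have [f fE] : exists f : 'M[R[i]]_n -> R, forall X, f X = cpart b (mxRe X i j).
  by eexists.
have fD X Y : f (X + Y) = f X + f Y by rewrite !fE mxReD mxE cpartD.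
have e1 : clark_part B k b i j U = f (mcayley (sqr_iter B k U)) := esym (fE _).
have e2 : clark_part B k b i j (umul V U) = f (mcayley (- sqr_iter B k U)).
  by rewrite fE /clark_part VN.
have e3 : clark_part B k.+1 b i j U = f (mcayley (sqr_iter B k U *m sqr_iter B k U)) :=
  esym (fE _).
have e := etrans (esym (fD _ _)) (etrans (congr1 f (mcayleyDN u1 u2)) (fD _ _)).
rewrite e1 e2 e3 e; move: (f _) => a.
by field.
Qed.

Lemma clark_part_measurable B k b i j : (forall U, 1%:M - sqr_iter B 0 U \in unitmx) ->
  measurable_fun setT (clark_part B k b i j).
Proof.
move=> u0; apply: continuous_borel_measurable => U.
have uk := sqr_iter_unitmx k u0.
exact: (@cvg_cpart_mcayley R n b i j _ _ (nbhs_filter U) (sqr_iter B k)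
  (sqr_iter B k U) uk (uk U) (@mxcvg_sqr_iter B k U)).
Qed.

(** Each level is the mean of two values of the preceding one, so a bound at level 0 persists. *)
Lemma clark_part_bound B k b i j (M : R) : (forall U, 1%:M - sqr_iter B 0 U \in unitmx) ->
  (forall U, `|clark_part B 0 b i j U| <= M) ->
  forall U, `|clark_part B k b i j U| <= M.
Proof.
move=> u0 b0; elim: k => [//|k IH] U.
have [V VN] := sqr_iter_neg B k; rewrite (clark_partS b i j u0 (VN U)).
rewrite normrM ger0_norm// ler_pdivrMl// mulr_natl mulr2n.
by apply: le_trans (ler_normD _ _) _; rewrite lerD.
Qed.

Lemma Rintegral_clark_partS B k b i j (M : R) :
  (forall U, 1%:M - sqr_iter B 0 U \in unitmx) ->
  (forall U, `|clark_part B 0 b i j U| <= M) ->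
  Rintegral H setT (clark_part B k.+1 b i j) = Rintegral H setT (clark_part B k b i j).
Proof.
move=> u0 b0; have [V VN] := sqr_iter_neg B k.
have bk : bounded_measurable (clark_part B k b i j).
  by split; [exact: clark_part_measurable|exists M; exact: clark_part_bound].
exact: (Rintegral_haar_avg bk (fun U => clark_partS b i j u0 (VN U))).
Qed.

Lemma sqr_iter_contraction A (s : R) k U : 0 <= s -> s <= 1 -> contraction A ->
  exists2 V, contraction V & sqr_iter (s%:C *: A) k U = (s ^+ (2 ^ k))%:C *: V.
Proof.
move=> s0 s1 cA; elim: k => [|k [V cV VE]] /=.
  exists (A *m (set_val U)^t*); last by rewrite expr1 -scalemxAl.
  apply: contractionM => //; apply: contraction_unitary.
  by rewrite trmxC_unitary; exact: (set_valP U).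
exists (V *m V); first exact: contractionM.
by rewrite VE -scalemxAl -scalemxAr scalerA -rmorphM /= -exprD addnn -mul2n expnS.
Qed.

Lemma sqr_iter_cvg0 A (s : R) U : 0 <= s -> s < 1 -> contraction A ->
  mxcvg \oo (fun k => sqr_iter (s%:C *: A) k U) 0.
Proof.
move=> s0 s1 cA i j; rewrite mxE.
apply/cvgrPdist_lt => e e0.
have eE : e = (complex.Re e)%:C.
  by case: e e0 => a b; rewrite ltcE /= => /andP[/eqP -> _].
have e0' : 0 < complex.Re e by rewrite -(ltcR 0) -eE.
have : s ^+ k @[k --> \oo] --> 0 by apply: cvg_expr; rewrite ger0_norm.
move=> /cvgrPdist_lt/(_ _ e0'); apply: filterS => k.
rewrite !sub0r !normrN ger0_norm ?exprn_ge0// => sk.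
have [V cV ->] := sqr_iter_contraction k U s0 (ltW s1) cA.
rewrite mxE normrM normr_realC [`|s ^+ _|]ger0_norm ?exprn_ge0//.
apply: (@le_lt_trans _ _ (s ^+ (2 ^ k))%:C).
  by apply: ler_piMr; [rewrite ler0c exprn_ge0|exact: contraction_entry].
(* [s ^+ (2 ^ k) <= s ^+ k], since [k <= 2 ^ k] and [0 <= s <= 1]. *)
rewrite eE ltcR; apply: le_lt_trans sk.
by apply: ler_wiXn2l => //; [exact: ltW|exact/ltnW/ltn_expl].
Qed.

(** The integrals form a constant sequence in [k], while their integrands tend boundedly to the
    value at the zero matrix. *)
Lemma Rintegral_clark_part_lt1 A (s : R) b i j (M : R) :
  0 <= s -> s < 1 -> contraction A ->
  (forall U, 1%:M - sqr_iter (s%:C *: A) 0 U \in unitmx) ->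
  (forall U, `|clark_part (s%:C *: A) 0 b i j U| <= M) ->
  Rintegral H setT (clark_part (s%:C *: A) 0 b i j) = cpart b ((1%:M : 'M[R[i]]_n) i j).
Proof.
move=> s0 s1 cA u0 b0.
have [] := @Rintegral_bounded_cvg _ _ _ H (fun k => clark_part (s%:C *: A) k b i j)
  (fun=> cpart b ((1%:M : 'M[R[i]]_n) i j)) M.
- by move=> k; exact: clark_part_measurable.
- by move=> k; exact: clark_part_bound.
- move=> U; rewrite -mxRe1 -mcayley0; apply: cvg_cpart_mcayley.
  + by move=> k; exact: sqr_iter_unitmx.
  + by rewrite subr0 unitmx1.
  + exact: sqr_iter_cvg0.
move=> _.
have -> : (fun k => Rintegral H setT (clark_part (s%:C *: A) k b i j)) =
    (fun=> Rintegral H setT (clark_part (s%:C *: A) 0 b i j)).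
  apply/funext; elim=> [|k IH]; first exact: erefl.
  exact: (etrans (Rintegral_clark_partS k u0 b0) IH).
rewrite Rintegral_probability_cst => /cvg_lim <- //.
by apply/esym/cvg_lim => //; exact: cvg_cst.
Qed.

Lemma Rintegral_clark_part A b i j (M : R) : contraction A ->
  (forall (s : R) U, 0 <= s -> s <= 1 -> 1%:M - sqr_iter (s%:C *: A) 0 U \in unitmx) ->
  (forall (s : R) U, 0 <= s -> s <= 1 -> `|clark_part (s%:C *: A) 0 b i j U| <= M) ->
  bounded_measurable (clark_part A 0 b i j) /\
  Rintegral H setT (clark_part A 0 b i j) = cpart b ((1%:M : 'M[R[i]]_n) i j).
Proof.
move=> cA u0 b0.
(* A sequence in [[0, 1)] tending to 1; the shift [m.+1] makes it start at 0. *)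
pose s (m : nat) : R := 1 - m.+1%:R^-1.
have s0 m : 0 <= s m by rewrite subr_ge0 invf_le1// ler1n.
have s1 m : s m < 1 by rewrite ltrBlDr ltrDl invr_gt0.
have sl m : s m <= 1 := ltW (s1 m).
have [] := @Rintegral_bounded_cvg _ _ _ H (fun m => clark_part ((s m)%:C *: A) 0 b i j)
  (clark_part A 0 b i j) M.
- by move=> m; apply: clark_part_measurable => U; exact: u0.
- by move=> m U; exact: b0.
- move=> U; apply: cvg_cpart_mcayley.
  + by move=> m; exact: u0.
  + by have := u0 1 U ler01 (lexx 1); rewrite scale1r.
  rewrite -[X in mxcvg _ _ X]scale1r.
  have -> : (fun m => sqr_iter ((s m)%:C *: A) 0 U) = (fun m => (s m)%:C *: sqr_iter A 0 U).
    by apply/funext => m; rewrite /= scalemxAl.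
  apply: mxcvgZ; last exact: mxcvg_cst.
  apply: (@cvg_realC _ _ _ _ s 1).
  rewrite -[X in _ --> X](subr0 1); apply: cvgB; first exact: cvg_cst.
  exact: cvg_harmonic.
move=> bA cl; split => //.
have E m := Rintegral_clark_part_lt1 (s0 m) (s1 m) cA (fun U => u0 _ U (s0 m) (sl m))
  (fun U => b0 _ U (s0 m) (sl m)).
move: cl; under eq_fun do rewrite E.
by move=> /cvg_lim <- //; apply/cvg_lim => //; exact: cvg_cst.
Qed.

End haar_average.

(** * Averages of Clark measures *)

Section density_induction.
Variable R : realType.

Lemma circle_continuousD (f g : circle R -> R) : continuous f -> continuous g ->
  continuous (fun x => f x + g x).
Proof. by move=> cf cg x; exact: (continuousD (cf x) (cg x)). Qed.

Lemma circle_continuousZ (c : R) (g : circle R -> R) : continuous g ->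
  continuous (fun x => c * g x).
Proof.
move=> cg x; have cc : continuous (fun _ : circle R => c) by exact: cst_continuous.
exact: (continuousM (cc x) (cg x)).
Qed.

Lemma continuous_pker (z : R[i]) : `|z| < 1 -> continuous (pker z).
Proof. by move=> /continuous_herglotz_kernel[]. Qed.

(** Density of the Poisson kernels as an induction principle, used for [Omega 0] and for the Haar
    average. The continuity premises give each case the bounded measurability that linearity of the
    integral requires. *)
Lemma pker_ind (P : (circle R -> R) -> Prop) :
  (forall z : R[i], `|z| < 1 -> P (pker z)) ->
  (forall (c : R) g, continuous g -> P g -> P (fun x => c * g x)) ->
  (forall f g, continuous f -> continuous g -> P f -> P g -> P (fun x => f x + g x)) ->
  (forall (g : nat -> circle R -> R) u, (forall m, continuous (g m)) -> continuous u ->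
    (forall m, P (g m)) -> (forall m x, `|u x - g m x| <= m.+1%:R^-1) -> P u) ->
  forall u, continuous u -> P u.
Proof.
move=> Pp PZ PD Pl u cu.
have P0 : P (fun=> 0).
  have z0 : `|0 : R[i]| < 1 by rewrite normr0 ltr01.
  have := PZ 0 _ (continuous_pker z0) (Pp _ z0).
  by congr P; apply/funext => x; rewrite mul0r.
have sumP N (c : 'I_N -> R) (z : 'I_N -> R[i]) (s : seq 'I_N) : (forall k, `|z k| < 1) ->
    continuous (fun x => \sum_(k <- s) c k * pker (z k) x) /\
    P (fun x => \sum_(k <- s) c k * pker (z k) x).
  move=> z1; elim: s => [|k s [cs Ps]].
    have -> : (fun x => \sum_(k <- [::]) c k * pker (z k) x) = (fun=> 0).
      by apply/funext => x; rewrite big_nil.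
    by split => //; exact: cst_continuous.
  have -> : (fun x => \sum_(k <- k :: s) c k * pker (z k) x) =
      (fun x => c k * pker (z k) x + \sum_(k <- s) c k * pker (z k) x).
    by apply/funext => x; rewrite big_cons.
  have ck : continuous (fun x => c k * pker (z k) x).
    by apply: circle_continuousZ; exact: continuous_pker.
  split; first exact: circle_continuousD.
  by apply: PD => //; apply: PZ; [exact: continuous_pker|exact: Pp].
have approx m : exists g : circle R -> R,
    [/\ continuous g, P g & forall x, `|u x - g x| <= m.+1%:R^-1].
  have [|N [c [z [z1 ug]]]] := @pker_dense R u (m.+1%:R^-1) cu.
    by rewrite invr_gt0.
  exists (fun x => \sum_k c k * pker (z k) x).
  by have [cs Ps] := sumP N c z (index_enum _) z1; split.
have [g gP] := choice approx.
by apply: (Pl g) => // m; have [] := gP m.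
Qed.

End density_induction.

Section clark_average.
Variables (R : realType) (n : nat).
Local Open Scope complex_scope.
Local Open Scope sesquilinear_scope.

Lemma mxlebesgue_setT : mxlebesgue R n setT = 1%:M.
Proof.
have z0 : `|0 : R[i]| < 1 by rewrite normr0 ltr01.
rewrite -[LHS]scale1r -(mxint_cst _ 1) -(mxint_mxlebesgue_pker n z0).
by congr (mxint _ _); apply/funext => x; rewrite pker0.
Qed.

(** [mxint_bound] applied to [u - g m] bounds the error by [2 / (m + 1)]. *)
Lemma mxint_part_cvg (Om : pos_mxmeasure R n) (g : nat -> circle R -> R)
    (u : circle R -> R) b i j :
  Om setT = 1%:M -> (forall m, continuous (g m)) -> continuous u ->
  (forall m x, `|u x - g m x| <= m.+1%:R^-1) ->
  cpart b (mxint Om (g m) i j) @[m --> \oo] --> cpart b (mxint Om u i j).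
Proof.
move=> Om1 cg cu ug.
have bg m := continuous_bounded_measurable (cg m).
have bu := continuous_bounded_measurable cu.
have d m : `|cpart b (mxint Om u i j) - cpart b (mxint Om (g m) i j)| <= 2 * m.+1%:R^-1.
  have cd : continuous (fun x => u x + -1 * g m x).
    by apply: circle_continuousD => //; exact: circle_continuousZ.
  have bd x : `|u x + -1 * g m x| <= m.+1%:R^-1 by rewrite mulN1r.
  have [] := mxint_bound Om1 (continuous_bounded_measurable cd) bd i j.
  have -> : mxint Om (fun x => u x + -1 * g m x) = mxint Om u - mxint Om (g m).
    rewrite mxintD//; last first.
      by apply: continuous_bounded_measurable; exact: circle_continuousZ.
    by rewrite mxintZ// rmorphN scaleN1r.
  rewrite !mxE.
  by case: b; rewrite /cpart !raddfB.
apply/cvgrPdist_le => e e0.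
have : 2 * (m.+1%:R^-1 : R) @[m --> \oo] --> (2 * 0 : R).
  by apply: cvgM; [exact: cvg_cst|exact: cvg_harmonic].
rewrite mulr0 => /cvgrPdist_le/(_ _ e0); apply: filterS => m.
rewrite sub0r normrN ger0_norm ?mulr_ge0 ?invr_ge0// => h.
exact: le_trans (d m) h.
Qed.

Lemma mxint_charge_eq (Om1 Om2 : pos_mxmeasure R n) :
  (forall u, continuous u -> mxint Om1 u = mxint Om2 u) ->
  forall E, measurable E -> Om1 E = Om2 E.
Proof.
move=> h E mE; apply/matrixP => i j.
have hR : mxmeas_Re Om1 i j E = mxmeas_Re Om2 i j E.
  apply: charge_eq_on_continuous => // u cu.
  by have /matrixP/(_ i j) := h u cu; rewrite !mxE => -[].
have hI : mxmeas_Im Om1 i j E = mxmeas_Im Om2 i j E.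
  apply: charge_eq_on_continuous => // u cu.
  by have /matrixP/(_ i j) := h u cu; rewrite !mxE => -[].
have eR : complex.Re (Om1 E i j) = complex.Re (Om2 E i j) := EFin_inj hR.
have eI : complex.Im (Om1 E i j) = complex.Im (Om2 E i j) := EFin_inj hI.
by apply/eqP; rewrite eq_complex eR eI !eqxx.
Qed.

Section clark_family.
Variable Theta : R[i] -> 'M[R[i]]_n.
Hypothesis Theta_contractive : contractive_on_disc Theta.
Hypothesis Theta0 : Theta 0 = 0.
Variable Omega : 'M[R[i]]_n -> pos_mxmeasure R n.
Hypothesis Omega_clark : forall A : 'M[R[i]]_n, opnorm A <= 1 ->
  is_clark_measure Theta A (Omega A).

Lemma opnorm_scaled_unitary (s : R) (U : unitary R n) : 0 <= s -> s <= 1 ->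
  opnorm (s%:C *: set_val U) <= 1.
Proof.
move=> s0 s1; apply: contraction_opnorm; apply: contractionZ => //.
by apply: contraction_unitary; exact: (set_valP U).
Qed.

(** For [A = 0] the Cayley transform is the identity at every [z], which is also the Poisson
    integral of [mxlebesgue]. *)
Lemma clark0 E : measurable E -> Omega 0 E = mxlebesgue R n E.
Proof.
have c0 : is_clark_measure Theta 0 (Omega 0).
  apply: Omega_clark; apply: contraction_opnorm => x.
  by rewrite mul0mx enorm0 enorm_ge0.
have m0 := clark_setT Theta0 c0; have m1 := mxlebesgue_setT.
apply: mxint_charge_eq; apply: pker_ind.
- move=> z z1; rewrite mxint_mxlebesgue_pker// -(clark_mxint c0 z1).
  by rewrite trmx0 map_mx0 mulmx0 mcayley0 mxRe1.
- move=> c g cg h; have bg := continuous_bounded_measurable cg.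
  by rewrite (mxintZ (Omega 0) c bg) (mxintZ (mxlebesgue R n) c bg) h.
- move=> f g cf cg hf hg; have bf := continuous_bounded_measurable cf.
  have bg := continuous_bounded_measurable cg.
  by rewrite (mxintD (Omega 0) bf bg) (mxintD (mxlebesgue R n) bf bg) hf hg.
- move=> g u cg cu hg ug; apply/matrixP => i j.
  have key b : cpart b (mxint (Omega 0) u i j) = cpart b (mxint (mxlebesgue R n) u i j).
    have h1 := mxint_part_cvg (b := b) (i := i) (j := j) m0 cg cu ug.
    have h2 := mxint_part_cvg (b := b) (i := i) (j := j) m1 cg cu ug.
    by apply: (cvg_seq_eq _ h1 h2) => m; rewrite hg.
  apply/eqP; rewrite eq_complex; apply/andP.
  by split; apply/eqP; [exact: (key false)|exact: (key true)].
Qed.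

Variable H : probability (borel (unitary R n)) R.
Hypothesis H_haar : is_haar H.

Definition clark_functional b i j (u : circle R -> R) (U : borel (unitary R n)) : R :=
  cpart b (mxint (Omega (set_val U)) u i j).

Let clarkU (U : unitary R n) : is_clark_measure Theta (set_val U) (Omega (set_val U)).
Proof.
by apply: Omega_clark; rewrite -(scale1r (set_val U)); exact: opnorm_scaled_unitary.
Qed.

Lemma clark_haar_pker z b i j : `|z| < 1 ->
  bounded_measurable (clark_functional b i j (pker z)) /\
  Rintegral H setT (clark_functional b i j (pker z)) =
    cpart b (mxint (mxlebesgue R n) (pker z) i j).
Proof.
move=> z1; have cT := opnorm_contraction (Theta_contractive z1).
(* The scalar moves from [Theta z] to the unitary, so that invertibility and bounds for [s < 1] come
   from the Clark measures of the contractions [s U]. *)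
have sE (s : R) (U : unitary R n) :
    sqr_iter (s%:C *: Theta z) 0 U = Theta z *m (s%:C *: set_val U)^t*.
  by rewrite /= linearZ /= map_mxZ /= conj_realC -scalemxAr scalemxAl.
have [M hM] := clark_bound Theta0 z1.
have unit_s (s : R) (U : unitary R n) : 0 <= s -> s <= 1 ->
    1%:M - sqr_iter (s%:C *: Theta z) 0 U \in unitmx.
  move=> s0 s1; rewrite sE; apply: (clark_unitmx Theta0 _ z1).
  by apply: Omega_clark; exact: opnorm_scaled_unitary.
have bound_s (s : R) (U : unitary R n) : 0 <= s -> s <= 1 ->
    `|clark_part (s%:C *: Theta z) 0 b i j U| <= M.
  move=> s0 s1; rewrite /clark_part sE; apply: hM.
  by apply: Omega_clark; exact: opnorm_scaled_unitary.
have [bm im] := Rintegral_clark_part H_haar cT unit_s bound_s.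
have -> : clark_functional b i j (pker z) = clark_part (Theta z) 0 b i j.
  by apply/funext => U; rewrite /clark_functional /clark_part -(clark_mxint (clarkU U) z1).
by rewrite mxint_mxlebesgue_pker.
Qed.

(** Measurability in [U] is carried through the induction together with the value of the integral,
    as it is known beforehand for Poisson kernels only. *)
Lemma clark_haar u : continuous u -> forall b i j,
  bounded_measurable (clark_functional b i j u) /\
  Rintegral H setT (clark_functional b i j u) = cpart b (mxint (mxlebesgue R n) u i j).
Proof.
move: u; apply: pker_ind.
- by move=> z z1 b i j; exact: clark_haar_pker.
- move=> c g cg h b i j; have [bg ig] := h b i j.
  have bcg := continuous_bounded_measurable cg.
  have -> : clark_functional b i j (fun x => c * g x) =
      (fun U => c * clark_functional b i j g U).
    by apply/funext => U; rewrite /clark_functional (mxintZ _ c bcg) mxE cpart_realC.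
  rewrite (mxintZ (mxlebesgue R n) c bcg) mxE cpart_realC -ig; split.
    split; first by apply: measurable_funM; [exact: measurable_cst|exact: bg.1].
    have [M hM] := bg.2; exists (`|c| * M) => U.
    by rewrite normrM ler_wpM2l.
  exact: (RintegralZl _ measurableT (bounded_measurable_integrable H bg)).
- move=> f g cf cg hf hg b i j; have [bf ie] := hf b i j; have [bg ig] := hg b i j.
  have bcf := continuous_bounded_measurable cf.
  have bcg := continuous_bounded_measurable cg.
  have -> : clark_functional b i j (fun x => f x + g x) =
      (fun U => clark_functional b i j f U + clark_functional b i j g U).
    by apply/funext => U; rewrite /clark_functional (mxintD _ bcf bcg) mxE cpartD.
  rewrite (mxintD (mxlebesgue R n) bcf bcg) mxE cpartD -ie -ig; split.
    split; first exact: (measurable_funD bf.1 bg.1).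
    have [M1 hM1] := bf.2; have [M2 hM2] := bg.2; exists (M1 + M2) => U.
    by apply: le_trans (ler_normD _ _) _; apply: lerD.
  exact: (RintegralD measurableT (bounded_measurable_integrable H bf)
    (bounded_measurable_integrable H bg)).
- move=> g u cg cu hg ug b i j.
  have [M uM] := continuous_circle_bounded cu.
  (* The approximants differ from [u] by at most 1, which gives a majorant common to all [m] and
     [U]. *)
  have gM m x : `|g m x| <= M + 1.
    have -> : g m x = u x - (u x - g m x) by rewrite subKr.
    apply: le_trans (ler_normB _ _) _; apply: lerD => //.
    by apply: le_trans (ug m x) _; rewrite invf_le1// ler1n.
  have FM m U : `|clark_functional b i j (g m) U| <= 2 * (M + 1).
    have [h1 h2] := mxint_bound (clark_setT Theta0 (clarkU U))
      (continuous_bounded_measurable (cg m)) (gM m) i j.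
    by rewrite /clark_functional; case: b.
  have Fl U : clark_functional b i j (g m) U @[m --> \oo] --> clark_functional b i j u U.
    exact: (mxint_part_cvg (clark_setT Theta0 (clarkU U)) cg cu ug).
  have mF m : measurable_fun setT (clark_functional b i j (g m)) := (hg m b i j).1.1.
  have [bF cF] := Rintegral_bounded_cvg H mF FM Fl.
  split=> //.
  have h2 := mxint_part_cvg (b := b) (i := i) (j := j) mxlebesgue_setT cg cu ug.
  exact: (cvg_seq_eq (fun m => (hg m b i j).2) cF h2).
Qed.

(** Real and imaginary parts of the entries are combinations of the functionals of [clark_haar] at
    the real and imaginary parts of [f]. *)
Lemma clark_haar_mxintegral (f : circle R -> R[i]) : continuous f ->
  mxintegrable H
    (fun U : borel (unitary R n) => mxintegral (Omega (set_val U)) f) /\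
  integral_mx H
    (fun U : borel (unitary R n) => mxintegral (Omega (set_val U)) f) =
  mxintegral (mxlebesgue R n) f.
Proof.
move=> cf.
have cu : continuous (fun x => complex.Re (f x)).
  by move=> x; exact: (@cvg_Re _ _ _ (nbhs_filter x) f _ (@cf x)).
have cv : continuous (fun x => complex.Im (f x)).
  by move=> x; exact: (@cvg_Im _ _ _ (nbhs_filter x) f _ (@cf x)).
pose u x := complex.Re (f x); pose v x := complex.Im (f x).
have ReE Om i j : complex.Re (mxintegral Om f i j) =
    cpart false (mxint Om u i j) - cpart true (mxint Om v i j).
  by rewrite !mxE.
have ImE Om i j : complex.Im (mxintegral Om f i j) =
    cpart true (mxint Om u i j) + cpart false (mxint Om v i j).
  by rewrite !mxE /= addrC.
have Re_fun i j : (fun U : borel (unitary R n) =>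
    complex.Re (mxintegral (Omega (set_val U)) f i j)) =
  (fun U => clark_functional false i j u U - clark_functional true i j v U).
  by apply/funext => U; rewrite ReE.
have Im_fun i j : (fun U : borel (unitary R n) =>
    complex.Im (mxintegral (Omega (set_val U)) f i j)) =
  (fun U => clark_functional true i j u U + clark_functional false i j v U).
  by apply/funext => U; rewrite ImE.
have int_u b i j := bounded_measurable_integrable H (clark_haar cu b i j).1.
have int_v b i j := bounded_measurable_integrable H (clark_haar cv b i j).1.
split=> [i j|].
  split.
    rewrite (_ : (fun _ => _) = (EFin \o (fun U => clark_functional false i j u U -
      clark_functional true i j v U))).
      exact: (integrableB measurableT (int_u false i j) (int_v true i j)).
    by apply/funext => U; rewrite ReE.
  rewrite (_ : (fun _ => _) = (EFin \o (fun U => clark_functional true i j u U +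
    clark_functional false i j v U))).
    exact: (integrableD measurableT (int_u true i j) (int_v false i j)).
  by apply/funext => U; rewrite ImE.
apply/matrixP => i j; rewrite mxE Re_fun Im_fun.
rewrite (RintegralB measurableT (int_u false i j) (int_v true i j)).
rewrite (RintegralD measurableT (int_u true i j) (int_v false i j)).
rewrite (clark_haar cu false i j).2 (clark_haar cu true i j).2.
rewrite (clark_haar cv false i j).2 (clark_haar cv true i j).2.
by rewrite -ReE -ImE; case: (mxintegral _ _ _ _).
Qed.

End clark_family.

End clark_average.

Theorem theorem2p2p3 (R : realType) (n : nat)
  (Theta : R[i] -> 'M[R[i]]_n)
  (Theta_analytic : analytic_on_disc Theta)
  (Theta_contractive : contractive_on_disc Theta)
  (Theta0 : Theta 0 = 0)
  (H : probability (borel (unitary R n)) R)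
  (H_haar : is_haar H)
  (Omega : 'M[R[i]]_n -> pos_mxmeasure R n)
  (Omega_clark : forall A : 'M[R[i]]_n, opnorm A <= 1 ->
     is_clark_measure Theta A (Omega A)) :
  (forall E : set (borel (circle R)), measurable E ->
     Omega 0 E = mxlebesgue R n E) /\
  (forall f : circle R -> R[i], continuous f ->
     mxintegrable H
       (fun U : borel (unitary R n) => mxintegral (Omega (set_val U)) f) /\
     integral_mx H
       (fun U : borel (unitary R n) => mxintegral (Omega (set_val U)) f) =
     mxintegral (mxlebesgue R n) f).
Proof.
split; first by move=> E; exact: (clark0 Theta0 Omega_clark).
by move=> f cf; exact: (clark_haar_mxintegral Theta_contractive Theta0 Omega_clark H_haar cf).
Qed.
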